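(* Let $n=n(r)$ be a smooth strictly positive refractive index, and let $g=n(r)^2\,(dr^2+r^2d\theta^2)$ be the associated Riemannian metric on $\mathbb{R}^2$. Let $\gamma$ be a geodesic circle of $(\mathbb{R}^2,g)$ centered at the origin, such that the region bounded by $\gamma$ (including $\gamma$) is contained in a totally normal neighborhood of $(\mathbb{R}^2,g)$. Then the optical billiard map $T$ associated with $\gamma$ and $n$ is totally integrable, i.e. the phase space $S^1\times(0,\pi)$ is foliated by rotational curves that are invariant under $T$.
   Context: Here $(r,\theta)$ are standard polar coordinates on $\mathbb{R}^2$, and $n$ is a function of the Euclidean distance $r$ to the origin, such that $g=n(r)^2(dr^2+r^2d\theta^2)$ is a smooth Riemannian metric on $\mathbb{R}^2$ (including at the origin). The metric $g$ is conformal to the Euclidean metric, so angles for $g$ and Euclidean angles coincide. Half-lines from the origin are geodesics of $g$, and a Euclidean circle of radius $R$ centered at the origin is a geodesic circle centered at the origin of radius $\int_0^R n(r)\,dr$. Totally normal neighborhood: an open set $W\subset\mathbb{R}^2$ for which there is $\delta>0$ such that, for every $q\in W$, the exponential map $\exp_q$ of $g$ is a diffeomorphism from the ball $B_\delta(0)\subset T_q\mathbb{R}^2$ onto its image and $W\subset\exp_q(B_\delta(0))$. Optical billiard map: orient $\gamma$ counterclockwise and parametrize it by the polar angle $\theta\in S^1=\mathbb{R}/2\pi\mathbb{Z}$. A state is a pair $(\theta_0,\alpha_0)\in S^1\times(0,\pi)$, where $\theta_0$ is the parameter of a point of $\gamma$ and $\alpha_0$ is the angle, measured from the positively oriented tangent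 of $\gamma$ at this point towards the interior of the region, of the outgoing direction. From $\gamma(\theta_0)$ one follows the $g$-geodesic with this direction until it first meets $\gamma$ again, at a point with parameter $\theta_1$. There it is reflected elastically (angle of incidence equals angle of reflection with respect to the tangent of $\gamma$), and $\alpha_1\in(0,\pi)$ is the angle of the new outgoing direction with the positively oriented tangent at $\gamma(\theta_1)$. Then $T(\theta_0,\alpha_0)=(\theta_1,\alpha_1)$. A rotational curve is a closed, simple, continuous curve in the cylinder $S^1\times(0,\pi)$ that is not homotopic to a point; it is invariant if $T$ maps it onto itself. *)

(* Defs.v *)
(* Stdlib reals with Coquelicot. *)
From Stdlib Require Import Reals.
From Coquelicot Require Import Coquelicot.

Open Scope R_scope.

(** * Riemannian metrics on the plane *)

Definition plane : Type := (R * R)%type.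

Inductive axis : Set := X1 | X2.

Definition coord (k : axis) (p : plane) : R :=
  match k with X1 => fst p | X2 => snd p end.

Definition partial (k : axis) (f : plane -> R) (p : plane) : R :=
  match k with
  | X1 => Derive (fun t => f (t, snd p)) (fst p)
  | X2 => Derive (fun t => f (fst p, t)) (snd p)
  end.

Definition sum_axis (f : axis -> R) : R := f X1 + f X2.

(* [ex_diff_n f m x y]: the iterated partial derivatives of [f] up to order [m]
   exist and are continuous at (x, y).  Only used with [U] open. *)
Definition smooth_on (U : plane -> Prop) (f : plane -> R) : Prop :=
  forall (m : nat) (x y : R), U (x, y) -> ex_diff_n (fun u v => f (u, v)) m x y.

Definition smooth_map_on (U : plane -> Prop) (F : plane -> plane) : Prop :=
  forall k : axis, smooth_on U (fun p => coord k (F p)).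

(* [g p i j] is the component g_ij at [p] in Cartesian coordinates. *)
Definition tensor : Type := plane -> axis -> axis -> R.

Definition ginner (g : tensor) (p v w : plane) : R :=
  sum_axis (fun i => sum_axis (fun j => g p i j * coord i v * coord j w)).

Definition gnorm (g : tensor) (p v : plane) : R := sqrt (ginner g p v v).

Definition riemannian_metric (g : tensor) : Prop :=
  (forall i j, smooth_on (fun _ => True) (fun p => g p i j)) /\
  (forall p i j, g p i j = g p j i) /\
  (forall p v, v <> (0, 0) -> 0 < ginner g p v v).

Definition gdet (g : tensor) (p : plane) : R :=
  g p X1 X1 * g p X2 X2 - g p X1 X2 * g p X2 X1.

Definition ginv (g : tensor) (p : plane) (i j : axis) : R :=
  match i, j with
  | X1, X1 => g p X2 X2 / gdet g p
  | X2, X2 => g p X1 X1 / gdet g p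
  | X1, X2 => - g p X1 X2 / gdet g p
  | X2, X1 => - g p X2 X1 / gdet g p
  end.

Definition christoffel (g : tensor) (k i j : axis) (p : plane) : R :=
  / 2 * sum_axis (fun l => ginv g p k l *
    (partial i (fun q => g q j l) p + partial j (fun q => g q i l) p
     - partial l (fun q => g q i j) p)).

Definition velocity (c : R -> plane) (t : R) : plane :=
  (Derive (fun s => coord X1 (c s)) t, Derive (fun s => coord X2 (c s)) t).

Definition geodesic_on (g : tensor) (a b : R) (c : R -> plane) : Prop :=
  forall t, a < t < b -> forall k : axis,
    ex_derive (fun s => coord k (c s)) t /\
    is_derive (fun s => coord k (velocity c s)) t
      (- sum_axis (fun i => sum_axis (fun j =>
           christoffel g k i j (c t)
           * coord i (velocity c t) * coord j (velocity c t)))).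

(* The exponential map as a partial function: exp_q(v) is defined and equals
   [p].  Metrics are not assumed complete. *)
Definition exp_map (g : tensor) (q v p : plane) : Prop :=
  exists (a b : R) (c : R -> plane),
    a < 0 /\ 1 < b /\ geodesic_on g a b c /\
    c 0 = q /\ velocity c 0 = v /\ c 1 = p.

Definition gball (g : tensor) (q : plane) (delta : R) (v : plane) : Prop :=
  gnorm g q v < delta.

Definition image (A : plane -> Prop) (F : plane -> plane) (p : plane) : Prop :=
  exists v, A v /\ F v = p.

Definition diffeomorphism_onto_image (A : plane -> Prop) (F : plane -> plane)
  : Prop :=
  open (image A F) /\ smooth_map_on A F /\
  exists G : plane -> plane,
    smooth_map_on (image A F) G /\ forall v, A v -> G (F v) = v.

Definition totally_normal_neighborhood (g : tensor) (W : plane -> Prop) : Prop :=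
  open W /\
  exists delta : R, 0 < delta /\
    forall q, W q ->
      exists E : plane -> plane,
        (forall v, gball g q delta v -> exp_map g q v (E v)) /\
        diffeomorphism_onto_image (gball g q delta) E /\
        (forall p, W p -> image (gball g q delta) E p).

Definition geodesic_circle (g : tensor) (q : plane) (rho : R)
  (S : plane -> Prop) : Prop :=
  0 < rho /\
  (forall v, gnorm g q v = rho -> exists p, exp_map g q v p) /\
  (forall p, S p <-> exists v, gnorm g q v = rho /\ exp_map g q v p).

(** * The radial optical metric *)

Definition enorm (p : plane) : R := sqrt (fst p ^ 2 + snd p ^ 2).

(* dr^2 + r^2 dtheta^2 is the Euclidean metric. *)
Definition optical_metric (n : R -> R) : tensor :=
  fun p i j => match i, j with
               | X1, X1 | X2, X2 => n (enorm p) ^ 2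
               | _, _ => 0
               end.

(* Only the values of [n] on the half-line r >= 0 matter; smoothness there,
   including at the endpoint 0, is the existence of a smooth extension. *)
Definition refractive_index (n : R -> R) : Prop :=
  (forall r, 0 <= r -> 0 < n r) /\
  (exists m : R -> R,
     (forall (k : nat) (r : R), ex_derive_n m k r) /\
     (forall r, 0 <= r -> m r = n r)).

(** * Closed curves parametrized by the polar angle *)

Definition polar_parametrization (gamma : R -> plane) : Prop :=
  (forall theta, gamma (theta + 2 * PI) = gamma theta) /\
  (forall theta, exists r, 0 < r /\ gamma theta = (r * cos theta, r * sin theta)).

Definition trace (gamma : R -> plane) (p : plane) : Prop :=
  exists theta, gamma theta = p.

(* The region bounded by a curve which is star-shaped about the origin, the
   curve included. *)
Definition closed_region (gamma : R -> plane) (p : plane) : Prop :=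
  exists s theta, 0 <= s <= 1 /\
    p = (s * fst (gamma theta), s * snd (gamma theta)).

(** * The optical billiard map *)

Definition dot (u v : plane) : R := fst u * fst v + snd u * snd v.

Definition vscale (l : R) (v : plane) : plane := (l * fst v, l * snd v).

Definition tangent (gamma : R -> plane) (theta : R) : plane :=
  vscale (/ enorm (velocity gamma theta)) (velocity gamma theta).

(* Unit vector at angle [alpha] from the tangent towards the interior, which
   lies to the left of a curve oriented counterclockwise: the inward normal is
   the tangent rotated by + PI/2.  The optical metric being conformal, its
   angles are the Euclidean ones. *)
Definition direction (gamma : R -> plane) (theta alpha : R) : plane :=
  let tau := tangent gamma theta in
  (cos alpha * fst tau - sin alpha * snd tau,
   cos alpha * snd tau + sin alpha * fst tau).

(* Reflection in the line spanned by the unit vector [u]. *)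
Definition reflect (u w : plane) : plane :=
  (2 * dot u w * fst u - fst w, 2 * dot u w * snd u - snd w).

(* S^1 = R / 2 PI Z is realized as the unit circle. *)
Definition phase : Type := (plane * R)%type.

Definition state (theta alpha : R) : phase := ((cos theta, sin theta), alpha).

Definition cylinder (s : phase) : Prop :=
  enorm (fst s) = 1 /\ 0 < snd s < PI.

Definition billiard_step (n : R -> R) (gamma : R -> plane) (s0 s1 : phase)
  : Prop :=
  exists (theta0 alpha0 theta1 alpha1 : R),
    s0 = state theta0 alpha0 /\ 0 < alpha0 < PI /\
    s1 = state theta1 alpha1 /\ 0 < alpha1 < PI /\
    exists (a b t1 l m : R) (c : R -> plane),
      a < 0 /\ 0 < t1 < b /\ 0 < l /\ 0 < m /\
      geodesic_on (optical_metric n) a b c /\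
      c 0 = gamma theta0 /\
      velocity c 0 = vscale l (direction gamma theta0 alpha0) /\
      (forall t, 0 < t < t1 -> ~ trace gamma (c t)) /\
      c t1 = gamma theta1 /\
      reflect (tangent gamma theta1) (velocity c t1)
        = vscale m (direction gamma theta1 alpha1).

(* [T] is everywhere defined on the phase space, and the billiard law
   determines its values; its values off the cylinder are irrelevant. *)
Definition optical_billiard_map (n : R -> R) (gamma : R -> plane)
  (T : phase -> phase) : Prop :=
  forall s, cylinder s -> forall s', billiard_step n gamma s s' <-> s' = T s.

(** * Rotational curves and total integrability *)

Definition unit_interval (t : R) : Prop := 0 <= t <= 1.

Definition simple_closed_curve (c : R -> phase) : Prop :=
  (forall t, unit_interval t -> cylinder (c t)) /\
  continuous_on unit_interval c /\
  c 0 = c 1 /\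
  (forall t t', 0 <= t < 1 -> 0 <= t' < 1 -> c t = c t' -> t = t').

(* Free homotopy, through closed curves in the cylinder, to a constant. *)
Definition homotopic_to_point (c : R -> phase) : Prop :=
  exists (H : R * R -> phase) (s0 : phase),
    (forall u t, unit_interval u -> unit_interval t -> cylinder (H (u, t))) /\
    continuous_on (fun z => unit_interval (fst z) /\ unit_interval (snd z)) H /\
    (forall u, unit_interval u -> H (u, 0) = H (u, 1)) /\
    (forall t, unit_interval t -> H (0, t) = c t) /\
    (forall t, unit_interval t -> H (1, t) = s0).

Definition rotational_curve (L : phase -> Prop) : Prop :=
  exists c : R -> phase,
    simple_closed_curve c /\ ~ homotopic_to_point c /\
    (forall s, L s <-> exists t, unit_interval t /\ c t = s).

Definition invariant (T : phase -> phase) (L : phase -> Prop) : Prop :=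
  forall s, L s <-> exists s', L s' /\ T s' = s.

Definition open_box (z : R * R) : Prop :=
  -1 < fst z < 1 /\ -1 < snd z < 1.

(* A foliation chart at [s]: a homeomorphism from a relatively open
   neighborhood [U] of [s] in the cylinder onto an open box, each horizontal
   segment of which lies in a single leaf. *)
Definition foliation_chart (Leaf : (phase -> Prop) -> Prop) (s : phase) : Prop :=
  exists (U : phase -> Prop) (phi : phase -> R * R) (psi : R * R -> phase),
    U s /\
    (forall x, U x -> cylinder x /\ locally x (fun y => cylinder y -> U y)) /\
    (forall x, U x -> open_box (phi x) /\ psi (phi x) = x) /\
    (forall z, open_box z -> U (psi z) /\ phi (psi z) = z) /\
    continuous_on U phi /\ continuous_on open_box psi /\
    (forall x y L, U x -> U y -> snd (phi x) = snd (phi y) ->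
       Leaf L -> L x -> L y).

Definition foliation (Leaf : (phase -> Prop) -> Prop) : Prop :=
  (forall L s, Leaf L -> L s -> cylinder s) /\
  (forall s, cylinder s -> exists L, Leaf L /\ L s) /\
  (forall L L' s, Leaf L -> Leaf L' -> L s -> L' s -> forall x, L x <-> L' x) /\
  (forall s, cylinder s -> foliation_chart Leaf s).

Definition totally_integrable (T : phase -> phase) : Prop :=
  exists Leaf : (phase -> Prop) -> Prop,
    foliation Leaf /\
    (forall L, Leaf L -> rotational_curve L /\ invariant T L).

(* Main.v *)
(* Rotations and the conservation laws do all the work. Energy n^2 |c'|^2 and
   angular momentum n^2 (c x c') are constant along geodesics, and n takes a
   single value on the circle, so a geodesic arc between two boundary points
   makes the same angle with the circle at both ends: alpha is invariant under T.
   T commutes with rotations, hence permutes each circle {alpha = const}, and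
   these circles foliate the cylinder. That T is well defined uses uniqueness of
   geodesics (Gronwall) and, for the existence of a first return, the totally
   normal neighborhood: a radius of the ball of exp_q cannot be mapped entirely
   into the compact disk, since exp_q has a continuous inverse there. *)
Require Import Defs.
From Stdlib Require Import Reals Ranalysis5 Lra Lia Psatz Classical IndefiniteDescription.
From Coquelicot Require Import Coquelicot.

(** Cartesian coordinates are used throughout, because polar ones are singular at the origin and the
    geodesics launched with [alpha] equal to PI/2 run through it. Derivatives are therefore taken of
    the smooth metric component n^2 and never of [n] or [enorm]; radial symmetry enters only as
    invariance under [rotate]. No geodesic is computed explicitly. The launching speed in
    [billiard_step] is free, so uniqueness of the return point compares geodesics up to a linear
    change of time. That [alpha] lies strictly between 0 and PI is used twice: the initial velocity
    points strictly inward, so the orbit enters the disk before it comes back, and cosine is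
    injective there, so the conserved angular momentum determines the angle. That a level curve is
    not contractible is proved with lifts instead of a general degree theory: an angle function
    gaining 2 PI over one turn is carried across a homotopy in small steps, and a constant loop has
    none. *)

(** * Compactness of intervals and squares *)

Lemma is_derive_continuity_pt (f : R -> R) (t l : R) :
  is_derive f t l -> continuity_pt f t.
Proof.
  intros H. apply continuity_pt_filterlim.
  apply (ex_derive_continuous (V := R_NormedModule)). now exists l.
Qed.

Lemma continuous_bounded_on_interval (f : R -> R) (a b : R) :
  a <= b -> (forall t, a <= t <= b -> continuity_pt f t) ->
  exists M, forall t, a <= t <= b -> Rabs (f t) <= M.
Proof.
  intros Hab Hf.
  destruct (continuity_ab_maj (fun t => Rabs (f t)) a b Hab) as [m [Hm _]].
  - intros t Ht. apply (continuity_pt_comp f Rabs); [now apply Hf|].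
    apply Rcontinuity_abs.
  - now exists (Rabs (f m)).
Qed.

Definition in_box (M x y : R) : Prop := Rabs x <= M /\ Rabs y <= M.

Lemma in_box_iff (M x y : R) : in_box M x y <-> -M <= x <= M /\ -M <= y <= M.
Proof.
  unfold in_box; split; intros [H1 H2]; split;
    solve [now apply Rabs_le_between | now apply Rabs_le].
Qed.

Lemma in_box_le (M M' x y : R) : M <= M' -> in_box M x y -> in_box M' x y.
Proof. unfold in_box; intros; lra. Qed.

(* Heine-Borel for a property that holds locally with a constant: the gauge at
   a point is taken smaller than the inverse of the constant valid there. *)
Lemma box_uniform_constant (Q : R -> R -> R -> Prop) (B : R) :
  (forall x y M M', M <= M' -> Q x y M -> Q x y M') ->
  (forall x y, in_box B x y -> exists M, locally_2d (fun u v => Q u v M) x y) ->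
  exists M, 0 < M /\ forall x y, in_box B x y -> Q x y M.
Proof.
  intros Hmon Hloc.
  assert (Hg : forall p : R * R, exists d : posreal, in_box B (fst p) (snd p) ->
      forall u v, Rabs (u - fst p) < d -> Rabs (v - snd p) < d -> Q u v (/ d)).
  { intros [x y]; simpl. destruct (classic (in_box B x y)) as [H | H].
    - destruct (Hloc x y H) as [M [d Hd]].
      (* [M] carries no sign, so [Rmax M 1] is inverted in its place; monotonicity of [Q] absorbs
         the change. *)
      assert (HM : 0 < Rmax M 1) by (pose proof (Rmax_r M 1); lra).
      assert (Hpos : 0 < Rmin d (/ Rmax M 1)).
      { apply Rmin_glb_lt; [apply cond_pos | now apply Rinv_0_lt_compat]. }
      exists (mkposreal _ Hpos); intros _ u v Hu Hv; cbn [pos fst snd] in Hu, Hv |- *.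
      pose proof (Rmin_l d (/ Rmax M 1)). pose proof (Rmin_r d (/ Rmax M 1)).
      apply (Hmon u v M); [| apply Hd; lra].
      apply Rle_trans with (Rmax M 1); [apply Rmax_l|].
      apply Rle_trans with (/ / Rmax M 1); [rewrite Rinv_inv; lra|].
      apply Rinv_le_contravar; lra.
    - exists (mkposreal 1 Rlt_0_1). tauto. }
  destruct (functional_choice _ Hg) as [gauge Hgauge].
  destruct (compactness_value_2d (-B) B (-B) B (fun u v => gauge (u, v)))
    as [d Hd].
  exists (/ d). split; [apply Rinv_0_lt_compat, cond_pos|].
  (* Compactness supplies the nearby centre [(u, v)] with a large gauge only under a double
     negation, hence the argument by contradiction. *)
  intros x y Hxy. apply NNPP; intros Hn.
  apply in_box_iff in Hxy as Hxy'.
  apply (Hd x y); [tauto | tauto |]. intros (u & v & Hu & Hv & Hxu & Hyv & Hle).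
  apply Hn. apply (Hmon x y (/ gauge (u, v))).
  - apply Rinv_le_contravar; [apply cond_pos | exact Hle].
  - apply (Hgauge (u, v)); simpl; auto. apply in_box_iff; tauto.
Qed.

Lemma continuous_bounded_on_box (f : R -> R -> R) (B : R) :
  (forall x y, continuity_2d_pt f x y) ->
  exists M, 0 < M /\ forall x y, in_box B x y -> Rabs (f x y) <= M.
Proof.
  intros Hf. apply (box_uniform_constant (fun x y M => Rabs (f x y) <= M)).
  - intros; lra.
  - intros x y _. exists (Rabs (f x y) + 1).
    destruct (Hf x y (mkposreal 1 Rlt_0_1)) as [d Hd]. exists d; intros u v Hu Hv.
    specialize (Hd u v Hu Hv); simpl in Hd.
    replace (f u v) with (f x y + (f u v - f x y)) by ring.
    pose proof (Rabs_triang (f x y) (f u v - f x y)); lra.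
Qed.

(** * Functions that are Lipschitz on bounded sets *)

Definition locally_lipschitz (f : R -> R -> R) : Prop :=
  forall B, exists L, 0 < L /\ forall x y x' y', in_box B x y -> in_box B x' y' ->
    Rabs (f x y - f x' y') <= L * (Rabs (x - x') + Rabs (y - y')).

Lemma lipschitz_segment (f df : R -> R) (B L : R) :
  (forall t, is_derive f t (df t)) ->
  (forall t, Rabs t <= B -> Rabs (df t) <= L) ->
  forall s t, Rabs s <= B -> Rabs t <= B -> Rabs (f s - f t) <= L * Rabs (s - t).
Proof.
  intros Hf Hdf s t Hs Ht.
  destruct (MVT_gen f t s df) as [c [Hc Heq]].
  - intros; apply Hf.
  - intros x _. now apply is_derive_continuity_pt with (df x).
  - rewrite Heq, Rabs_mult. apply Rmult_le_compat_r; [apply Rabs_pos|].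
    apply Hdf, Rabs_le. apply Rabs_le_between in Hs, Ht.
    revert Hc; unfold Rmin, Rmax; destruct (Rle_dec t s); lra.
Qed.

(** Moving one coordinate at a time stays in the square, and on each of the two segments the mean
    value theorem applies with a bound for one partial derivative. *)
Lemma C1_locally_lipschitz (f : R -> R -> R) :
  (forall x y, ex_diff_n f 1 x y) -> locally_lipschitz f.
Proof.
  intros Hf B.
  destruct (continuous_bounded_on_box (fun u v => Derive (fun z => f z v) u) B)
    as [L1 [HL1 H1]]; [intros x y; apply (Hf x y)|].
  destruct (continuous_bounded_on_box (fun u v => Derive (fun z => f u z) v) B)
    as [L2 [HL2 H2]]; [intros x y; apply (Hf x y)|].
  exists (L1 + L2). split; [lra|].
  intros x y x' y' [Hx Hy] [Hx' Hy'].
  assert (Ha : Rabs (f x y - f x' y) <= L1 * Rabs (x - x')).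
  { apply (lipschitz_segment (fun z => f z y) (Derive (fun z => f z y)) B); auto.
    - intros t; apply Derive_correct, (Hf t y).
    - intros t Ht; apply H1; now split. }
  assert (Hb : Rabs (f x' y - f x' y') <= L2 * Rabs (y - y')).
  { apply (lipschitz_segment (fun z => f x' z) (Derive (fun z => f x' z)) B); auto.
    - intros t; apply Derive_correct, (Hf x' t).
    - intros t Ht; apply H2; now split. }
  replace (f x y - f x' y') with ((f x y - f x' y) + (f x' y - f x' y')) by ring.
  pose proof (Rabs_triang (f x y - f x' y) (f x' y - f x' y')).
  pose proof (Rabs_pos (x - x')). pose proof (Rabs_pos (y - y')). nra.
Qed.

Lemma locally_lipschitz_bounded (f : R -> R -> R) (B : R) :
  locally_lipschitz f ->
  exists M, 0 < M /\ forall x y, in_box B x y -> Rabs (f x y) <= M.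
Proof.
  (* Values are compared with the one at the origin, which lies in the square of size [Rabs B]
     whatever the sign of [B]; the final 1 only makes the bound positive. *)
  intros Hf. destruct (Hf (Rabs B)) as [L [HL H]].
  exists (Rabs (f 0 0) + L * (2 * Rabs B) + 1). pose proof (Rabs_pos B).
  pose proof (Rabs_pos (f 0 0)). split; [nra|].
  intros x y Hxy. apply (in_box_le _ (Rabs B)) in Hxy; [| apply Rle_abs].
  assert (Hz : in_box (Rabs B) 0 0) by (split; rewrite Rabs_R0; lra).
  specialize (H x y 0 0 Hxy Hz). rewrite !Rminus_0_r in H. destruct Hxy.
  replace (f x y) with (f 0 0 + (f x y - f 0 0)) by ring.
  pose proof (Rabs_triang (f 0 0) (f x y - f 0 0)). nra.
Qed.

Lemma Rabs_mult_diff_le (a b a' b' A B : R) :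
  Rabs a <= A -> Rabs b' <= B ->
  Rabs (a * b - a' * b') <= A * Rabs (b - b') + B * Rabs (a - a').
Proof.
  intros Ha Hb.
  replace (a * b - a' * b') with (a * (b - b') + b' * (a - a')) by ring.
  eapply Rle_trans; [apply Rabs_triang|]. rewrite !Rabs_mult.
  apply Rplus_le_compat; apply Rmult_le_compat_r; auto using Rabs_pos.
Qed.

Lemma locally_lipschitz_mult (f g : R -> R -> R) :
  locally_lipschitz f -> locally_lipschitz g ->
  locally_lipschitz (fun x y => f x y * g x y).
Proof.
  intros Hf Hg B.
  destruct (locally_lipschitz_bounded f B Hf) as [Mf [HMf Bf]].
  destruct (locally_lipschitz_bounded g B Hg) as [Mg [HMg Bg]].
  destruct (Hf B) as [Lf [HLf Hf']], (Hg B) as [Lg [HLg Hg']].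
  exists (Mf * Lg + Mg * Lf). split; [nra|].
  intros x y x' y' H H'.
  eapply Rle_trans; [apply (Rabs_mult_diff_le _ _ _ _ Mf Mg); auto|].
  specialize (Hf' x y x' y' H H'). specialize (Hg' x y x' y' H H'). nra.
Qed.

(** Positivity alone gives no lower bound for [f]. Continuity of the reciprocal on a compact square
    bounds it by [M], and the difference of two reciprocals is their product times a difference of
    values of [f]. *)
Lemma locally_lipschitz_inv (f : R -> R -> R) :
  (forall x y, 0 < f x y) -> (forall x y, continuity_2d_pt f x y) ->
  locally_lipschitz f -> locally_lipschitz (fun x y => / f x y).
Proof.
  intros Hpos Hc Hf B.
  destruct (continuous_bounded_on_box (fun x y => / f x y) B) as [M [HM HB]].
  { intros x y. apply continuity_2d_pt_inv; auto. apply Rgt_not_eq, Hpos. }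
  destruct (Hf B) as [L [HL Hf']].
  exists (M * M * L). split; [repeat apply Rmult_lt_0_compat; lra|].
  intros x y x' y' H H'. pose proof (Hpos x y). pose proof (Hpos x' y').
  replace (/ f x y - / f x' y') with (/ f x y * / f x' y' * (f x' y' - f x y))
    by (field; lra).
  rewrite !Rabs_mult, (Rabs_minus_sym (f x' y')).
  specialize (Hf' x y x' y' H H'). pose proof (HB x y H). pose proof (HB x' y' H').
  pose proof (Rabs_pos (/ f x y)). pose proof (Rabs_pos (/ f x' y')).
  pose proof (Rabs_pos (f x y - f x' y')).
  replace (M * M * L * (Rabs (x - x') + Rabs (y - y')))
    with (M * M * (L * (Rabs (x - x') + Rabs (y - y')))) by ring.
  apply Rmult_le_compat; auto; [nra|]. apply Rmult_le_compat; auto.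
Qed.

(** The chain rule along a curve requires total differentiability, which continuity of the partial
    derivatives provides. *)
Lemma C1_differentiable (f : R -> R -> R) (x y : R) :
  (forall x y, ex_diff_n f 1 x y) ->
  differentiable_pt_lim f x y
    (Derive (fun z => f z y) x) (Derive (fun z => f x z) y).
Proof.
  intros Hf. apply filterdiff_differentiable_pt_lim.
  apply (is_derive_filterdiff f x y (fun u v => Derive (fun z => f z v) u)).
  - apply filter_forall; intros u. apply Derive_correct, (Hf (fst u) (snd u)).
  - apply Derive_correct, (Hf x y).
  - apply (proj1 (continuity_2d_pt_filterlim
                    (fun u v => Derive (fun z => f z v) u) x y)), (Hf x y).
Qed.

(** * Uniqueness of solutions of the geodesic equations *)

(* Geodesic equations of the metric e^(2 phi) (dx^2 + dy^2), where
   (f1, f2) is the gradient of phi. *)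
Definition conformal_flow (f1 f2 : R -> R -> R) (a b : R) (x y u v : R -> R)
  : Prop :=
  forall t, a < t < b ->
    is_derive x t (u t) /\ is_derive y t (v t) /\
    is_derive u t (f1 (x t) (y t) * (v t ^ 2 - u t ^ 2)
                   - 2 * f2 (x t) (y t) * (u t * v t)) /\
    is_derive v t (f2 (x t) (y t) * (u t ^ 2 - v t ^ 2)
                   - 2 * f1 (x t) (y t) * (u t * v t)).

(** The integrating factor exp(- K t) turns the differential inequality into monotonicity:
    [D t * exp (- K * t)] has nonpositive derivative and starts at 0. *)
Lemma gronwall_zero (D dD : R -> R) (K T : R) :
  0 <= T -> (forall t, 0 <= t <= T -> is_derive D t (dD t)) ->
  (forall t, 0 <= t <= T -> dD t <= K * D t) ->
  D 0 = 0 -> D T <= 0.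
Proof.
  intros HT Hd HK H0.
  assert (HF : forall t, 0 <= t <= T ->
    is_derive (fun t => D t * exp (- K * t)) t ((dD t - K * D t) * exp (- K * t))).
  { intros t Ht. evar_last.
    - apply (is_derive_mult (K := R_AbsRing) D (fun t => exp (- K * t)));
        [now apply Hd | | intros; apply Rmult_comm].
      auto_derive; [trivial | reflexivity].
    - unfold plus, mult; simpl. ring. }
  destruct (MVT_gen (fun t => D t * exp (- K * t)) 0 T
              (fun t => (dD t - K * D t) * exp (- K * t))) as [c [Hc Heq]].
  - rewrite Rmin_left, Rmax_right by lra. intros; apply HF; lra.
  - rewrite Rmin_left, Rmax_right by lra. intros.
    eapply is_derive_continuity_pt, HF; lra.
  - rewrite Rmin_left, Rmax_right in Hc by lra. rewrite H0 in Heq.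
    pose proof (HK c Hc). pose proof (exp_pos (- K * c)).
    pose proof (exp_pos (- K * T)) as HeT.
    assert (0 <= (K * D c - dD c) * exp (- K * c) * T)
      by (repeat apply Rmult_le_pos; lra).
    apply Rnot_lt_le; intros Hpos.
    pose proof (Rmult_lt_0_compat _ _ Hpos HeT). lra.
Qed.

(** The acceleration is a sum of products of a function of the position with a quadratic form in the
    velocity, both bounded and Lipschitz on squares. One estimate serves both components: the second
    arises from the first by exchanging [f] with [g] and [u] with [v]. *)
Lemma conformal_flow_field_lipschitz (f g : R -> R -> R) (B : R) :
  locally_lipschitz f -> locally_lipschitz g ->
  exists K, 0 <= K /\ forall x y u v x' y' u' v',
    in_box B x y -> in_box B x' y' -> in_box B u v -> in_box B u' v' ->
    Rabs ((f x y * (v ^ 2 - u ^ 2) - 2 * g x y * (u * v))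
          - (f x' y' * (v' ^ 2 - u' ^ 2) - 2 * g x' y' * (u' * v')))
    <= K * (Rabs (x - x') + Rabs (y - y') + (Rabs (u - u') + Rabs (v - v'))).
Proof.
  intros Hf Hg.
  assert (Hsq : forall s s', Rabs s <= B -> Rabs s' <= B ->
    Rabs (s * s - s' * s') <= 2 * B * Rabs (s - s')).
  { intros s s' Hs Hs'.
    eapply Rle_trans; [apply (Rabs_mult_diff_le _ _ _ _ B B); auto | lra]. }
  destruct (locally_lipschitz_bounded f B Hf) as [Mf [HMf Bf]].
  destruct (locally_lipschitz_bounded g B Hg) as [Mg [HMg Bg]].
  destruct (Hf B) as [Lf [HLf Lipf]], (Hg B) as [Lg [HLg Lipg]].
  destruct (Rle_or_lt 0 B) as [HB | HB].
  (* For negative [B] the square is empty. *)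
  2: { exists 0. split; [lra|]. intros x y u v x' y' u' v' [Hx _].
       pose proof (Rabs_pos x). lra. }
  exists (Mf * (2 * B) + 2 * (B * B) * Lf + 2 * (Mg * B + (B * B) * Lg)).
  split; [nra|].
  intros x y u v x' y' u' v' Hp Hp' [Hu Hv] [Hu' Hv'].
  specialize (Lipf x y x' y' Hp Hp'). specialize (Lipg x y x' y' Hp Hp').
  assert (H1 : Rabs ((v * v - u * u) - (v' * v' - u' * u'))
               <= 2 * B * (Rabs (u - u') + Rabs (v - v'))).
  { replace ((v * v - u * u) - (v' * v' - u' * u'))
      with ((v * v - v' * v') + - (u * u - u' * u')) by ring.
    eapply Rle_trans; [apply Rabs_triang|]. rewrite Rabs_Ropp.
    pose proof (Hsq u u' Hu Hu'). pose proof (Hsq v v' Hv Hv'). lra. }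
  assert (H2 : Rabs (u * v - u' * v') <= B * (Rabs (u - u') + Rabs (v - v'))).
  { eapply Rle_trans; [apply (Rabs_mult_diff_le _ _ _ _ B B); auto | lra]. }
  assert (Hq : forall s r, Rabs s <= B -> Rabs r <= B -> Rabs (s * r) <= B * B).
  { intros s r Hs Hr. rewrite Rabs_mult. apply Rmult_le_compat; auto using Rabs_pos. }
  assert (H3 : Rabs (v' * v' - u' * u') <= 2 * (B * B)).
  { unfold Rminus. eapply Rle_trans; [apply Rabs_triang|]. rewrite Rabs_Ropp.
    pose proof (Hq v' v' Hv' Hv'). pose proof (Hq u' u' Hu' Hu'). lra. }
  pose proof (Rabs_mult_diff_le (f x y) (v * v - u * u) (f x' y')
    (v' * v' - u' * u') Mf (2 * (B * B)) (Bf _ _ Hp) H3) as H4.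
  pose proof (Rabs_mult_diff_le (g x y) (u * v) (g x' y') (u' * v') Mg (B * B)
    (Bg _ _ Hp) (Hq _ _ Hu' Hv')) as H5.
  set (X := Rabs (x - x') + Rabs (y - y')) in *.
  set (U := Rabs (u - u') + Rabs (v - v')) in *.
  assert (HX : 0 <= X) by (unfold X; pose proof (Rabs_pos (x - x'));
                           pose proof (Rabs_pos (y - y')); lra).
  assert (HU : 0 <= U) by (unfold U; pose proof (Rabs_pos (u - u'));
                           pose proof (Rabs_pos (v - v')); lra).
  replace (_ - _) with
    ((f x y * (v * v - u * u) - f x' y' * (v' * v' - u' * u'))
     + - (2 * (g x y * (u * v) - g x' y' * (u' * v')))) by ring.
  eapply Rle_trans; [apply Rabs_triang|].
  rewrite Rabs_Ropp, Rabs_mult, (Rabs_right 2) by lra.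
  assert (H6 := Rmult_le_compat_l Mf _ _ (Rlt_le _ _ HMf) H1).
  assert (H7 := Rmult_le_compat_l Mg _ _ (Rlt_le _ _ HMg) H2).
  assert (HBB : 0 <= B * B) by nra.
  assert (H8 := Rmult_le_compat_l _ _ _ HBB Lipf).
  assert (H9 := Rmult_le_compat_l _ _ _ HBB Lipg).
  assert (0 <= Mf * (2 * B) * X) by (repeat apply Rmult_le_pos; lra).
  assert (0 <= Mg * B * X) by (repeat apply Rmult_le_pos; lra).
  assert (0 <= B * B * Lf * U) by (repeat apply Rmult_le_pos; lra).
  assert (0 <= B * B * Lg * U) by (repeat apply Rmult_le_pos; lra).
  lra.
Qed.

Lemma conformal_flow_bounded (f1 f2 : R -> R -> R) (a b T : R) (x y u v : R -> R) :
  a < 0 -> 0 <= T < b -> conformal_flow f1 f2 a b x y u v ->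
  exists M, forall t, 0 <= t <= T -> in_box M (x t) (y t) /\ in_box M (u t) (v t).
Proof.
  intros Ha HT H.
  assert (Hb : forall h : R -> R, (forall t, a < t < b -> exists l, is_derive h t l) ->
    exists M, forall t, 0 <= t <= T -> Rabs (h t) <= M).
  { intros h Hh. apply continuous_bounded_on_interval; [lra|].
    intros t Ht. destruct (Hh t) as [l Hl]; [lra|].
    now apply is_derive_continuity_pt with l. }
  destruct (Hb x) as [M1 H1]; [intros t Ht; destruct (H t Ht) as (? & ? & ? & ?); eauto|].
  destruct (Hb y) as [M2 H2]; [intros t Ht; destruct (H t Ht) as (? & ? & ? & ?); eauto|].
  destruct (Hb u) as [M3 H3]; [intros t Ht; destruct (H t Ht) as (? & ? & ? & ?); eauto|].
  destruct (Hb v) as [M4 H4]; [intros t Ht; destruct (H t Ht) as (? & ? & ? & ?); eauto|].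
  exists (Rmax (Rmax M1 M2) (Rmax M3 M4)). intros t Ht.
  specialize (H1 t Ht). specialize (H2 t Ht). specialize (H3 t Ht). specialize (H4 t Ht).
  pose proof (Rmax_l M1 M2). pose proof (Rmax_r M1 M2).
  pose proof (Rmax_l M3 M4). pose proof (Rmax_r M3 M4).
  pose proof (Rmax_l (Rmax M1 M2) (Rmax M3 M4)).
  pose proof (Rmax_r (Rmax M1 M2) (Rmax M3 M4)).
  unfold in_box; lra.
Qed.

(** Gronwall is applied to the squared distance [D] between the two solutions in position-velocity
    space. Both solutions stay in a common square up to the time considered, so local Lipschitz
    constants suffice. *)
Lemma conformal_flow_unique (f1 f2 : R -> R -> R) (a b a' b' : R)
  (x y u v x' y' u' v' : R -> R) :
  locally_lipschitz f1 -> locally_lipschitz f2 -> a < 0 -> a' < 0 ->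
  conformal_flow f1 f2 a b x y u v -> conformal_flow f1 f2 a' b' x' y' u' v' ->
  x 0 = x' 0 -> y 0 = y' 0 -> u 0 = u' 0 -> v 0 = v' 0 ->
  forall t, 0 <= t -> t < b -> t < b' -> x t = x' t /\ y t = y' t.
Proof.
  intros Hf1 Hf2 Ha Ha' H H' Hx Hy Hu Hv T HT HTb HTb'.
  destruct (conformal_flow_bounded _ _ _ _ T _ _ _ _ Ha (conj HT HTb) H) as [M HM].
  destruct (conformal_flow_bounded _ _ _ _ T _ _ _ _ Ha' (conj HT HTb') H') as [M' HM'].
  destruct (conformal_flow_field_lipschitz f1 f2 (Rmax M M') Hf1 Hf2) as [K1 [HK1 L1]].
  destruct (conformal_flow_field_lipschitz f2 f1 (Rmax M M') Hf2 Hf1) as [K2 [HK2 L2]].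
  set (A := fun t => f1 (x t) (y t) * (v t ^ 2 - u t ^ 2)
                     - 2 * f2 (x t) (y t) * (u t * v t)) in *.
  set (A' := fun t => f1 (x' t) (y' t) * (v' t ^ 2 - u' t ^ 2)
                     - 2 * f2 (x' t) (y' t) * (u' t * v' t)) in *.
  set (C := fun t => f2 (x t) (y t) * (u t ^ 2 - v t ^ 2)
                     - 2 * f1 (x t) (y t) * (u t * v t)) in *.
  set (C' := fun t => f2 (x' t) (y' t) * (u' t ^ 2 - v' t ^ 2)
                     - 2 * f1 (x' t) (y' t) * (u' t * v' t)) in *.
  set (D := fun t => (x t - x' t) ^ 2 + (y t - y' t) ^ 2
                     + (u t - u' t) ^ 2 + (v t - v' t) ^ 2).
  set (dD := fun t => 2 * ((x t - x' t) * (u t - u' t) + (y t - y' t) * (v t - v' t)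
                     + (u t - u' t) * (A t - A' t) + (v t - v' t) * (C t - C' t))).
  assert (HD : D T <= 0).
  (* With [S] the sum of the four absolute differences and [N] the value of [D], the derivative is
     at most 2 (N + 2 K1 N + 2 K2 N): the products of position and velocity differences give [S3],
     those with the acceleration differences [S1] and [S2]. *)
  { apply (gronwall_zero D dD (2 + 4 * (K1 + K2)) T HT).
    - intros t Ht.
      destruct (H t) as (dx & dy & du & dv); [lra|].
      destruct (H' t) as (dx' & dy' & du' & dv'); [lra|].
      assert (Hsq : forall (h k : R -> R) lh lk, is_derive h t lh -> is_derive k t lk ->
        is_derive (fun s => (h s - k s) ^ 2) t (2 * (h t - k t) * (lh - lk))).
      { intros h k lh lk Hh Hk. auto_derive.
        - repeat split; eexists; eassumption.
        - rewrite (is_derive_unique _ _ _ Hh : Derive (fun x => h x) t = _).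
          rewrite (is_derive_unique _ _ _ Hk : Derive (fun x => k x) t = _). ring. }
      evar_last.
      + unfold D. do 3 (apply (is_derive_plus (K := R_AbsRing) (V := R_NormedModule));
          [| eapply Hsq; eassumption]). eapply Hsq; eassumption.
      + unfold dD, A, A', C, C', plus; simpl. ring.
    - intros t Ht.
      destruct (HM t Ht) as [Bx Bu], (HM' t Ht) as [Bx' Bu'].
      apply (in_box_le _ (Rmax M M')) in Bx, Bu; [| apply Rmax_l | apply Rmax_l].
      apply (in_box_le _ (Rmax M M')) in Bx', Bu'; [| apply Rmax_r | apply Rmax_r].
      specialize (L1 _ _ _ _ _ _ _ _ Bx Bx' Bu Bu'). fold (A t) (A' t) in L1.
      assert (Cu : in_box (Rmax M M') (v t) (u t)) by (destruct Bu; now split).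
      assert (Cu' : in_box (Rmax M M') (v' t) (u' t)) by (destruct Bu'; now split).
      specialize (L2 _ _ _ _ _ _ _ _ Bx Bx' Cu Cu').
      rewrite (Rmult_comm (v t)), (Rmult_comm (v' t)) in L2. fold (C t) (C' t) in L2.
      unfold dD, D.
      set (p := x t - x' t) in *. set (q := y t - y' t) in *.
      set (r := u t - u' t) in *. set (s := v t - v' t) in *.
      rewrite <- (pow2_abs p), <- (pow2_abs q), <- (pow2_abs r), <- (pow2_abs s).
      assert (Hm : forall z w, z * w <= Rabs z * Rabs w)
        by (intros; rewrite <- Rabs_mult; apply Rle_abs).
      pose proof (Hm p r). pose proof (Hm q s).
      pose proof (Hm r (A t - A' t)). pose proof (Hm s (C t - C' t)).
      pose proof (Rabs_pos p) as Hp. pose proof (Rabs_pos q) as Hq.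
      pose proof (Rabs_pos r) as Hr. pose proof (Rabs_pos s) as Hs.
      set (S := Rabs p + Rabs q + (Rabs r + Rabs s)) in *.
      rewrite (Rplus_comm (Rabs s)) in L2. fold S in L2.
      assert (Rabs r * Rabs (A t - A' t) <= K1 * (Rabs r * S)) by nra.
      assert (Rabs s * Rabs (C t - C' t) <= K2 * (Rabs s * S)) by nra.
      set (P := Rabs p) in *. set (Q := Rabs q) in *.
      set (R' := Rabs r) in *. set (V := Rabs s) in *.
      set (N := P ^ 2 + Q ^ 2 + R' ^ 2 + V ^ 2).
      assert (S1 : R' * S <= 2 * N).
      { unfold S, N. pose proof (pow2_ge_0 (R' - P)). pose proof (pow2_ge_0 (R' - Q)).
        pose proof (pow2_ge_0 (R' - V)). nra. }
      assert (S2 : V * S <= 2 * N).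
      { unfold S, N. pose proof (pow2_ge_0 (V - P)). pose proof (pow2_ge_0 (V - Q)).
        pose proof (pow2_ge_0 (R' - V)). nra. }
      assert (S3 : P * R' + Q * V <= N).
      { unfold N. pose proof (pow2_ge_0 (P - R')). pose proof (pow2_ge_0 (Q - V)). nra. }
      assert (K1 * (R' * S) <= K1 * (2 * N)) by now apply Rmult_le_compat_l.
      assert (K2 * (V * S) <= K2 * (2 * N)) by now apply Rmult_le_compat_l.
      lra.
    - unfold D. rewrite Hx, Hy, Hu, Hv. ring. }
  unfold D in HD.
  assert (Hz : forall r, r ^ 2 <= 0 -> r = 0) by (intros; nra).
  pose proof (pow2_ge_0 (x T - x' T)). pose proof (pow2_ge_0 (y T - y' T)).
  pose proof (pow2_ge_0 (u T - u' T)). pose proof (pow2_ge_0 (v T - v' T)).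
  assert (x T - x' T = 0) by (apply Hz; lra).
  assert (y T - y' T = 0) by (apply Hz; lra). lra.
Qed.
(** * Geodesics of the optical metric *)

(** The conformal factor as a function of Cartesian coordinates; its smoothness, at the origin too,
    is that of a metric component. *)
Definition factor (n : R -> R) (x y : R) : R := n (enorm (x, y)) ^ 2.

(* (lgrad1, lgrad2) is the gradient of log n = log (n^2) / 2. *)
Definition lgrad1 (n : R -> R) (x y : R) : R :=
  Derive (fun z => factor n z y) x * (/ factor n x y * / 2).

Definition lgrad2 (n : R -> R) (x y : R) : R :=
  Derive (fun z => factor n x z) y * (/ factor n x y * / 2).

Lemma factor_pos (n : R -> R) (x y : R) :
  riemannian_metric (optical_metric n) -> 0 < factor n x y.
Proof.
  intros (_ & _ & H). assert (H1 : (1, 0) <> (0, 0)) by (intros E; apply (f_equal fst) in E; simpl in E; lra).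
  specialize (H (x, y) (1, 0) H1). unfold ginner, sum_axis in H; simpl in H.
  unfold factor; simpl. lra.
Qed.

Lemma factor_smooth (n : R -> R) (m : nat) (x y : R) :
  riemannian_metric (optical_metric n) -> ex_diff_n (factor n) m x y.
Proof. intros (H & _). exact (H X1 X1 m x y I). Qed.

Lemma lgrad_locally_lipschitz (n : R -> R) :
  riemannian_metric (optical_metric n) ->
  locally_lipschitz (lgrad1 n) /\ locally_lipschitz (lgrad2 n).
Proof.
  intros Hg.
  assert (Hinv : locally_lipschitz (fun x y => / factor n x y * / 2)).
  { apply (locally_lipschitz_mult (fun x y => / factor n x y) (fun _ _ => / 2)).
    - apply locally_lipschitz_inv.
      + intros; now apply factor_pos.
      + intros x y. apply (factor_smooth n 0 x y Hg).
      + apply C1_locally_lipschitz. intros; now apply factor_smooth.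
    - intros B. exists 1. split; [lra|]. intros x y x' y' _ _.
      rewrite Rminus_diag, Rabs_R0.
      pose proof (Rabs_pos (x - x')). pose proof (Rabs_pos (y - y')). lra. }
  (* Smoothness of order 2 for [factor n] includes smoothness of order 1 for each first partial
     derivative. *)
  split; refine (locally_lipschitz_mult _ _ _ Hinv); apply C1_locally_lipschitz;
    intros x y; apply (factor_smooth n 2 x y Hg).
Qed.

(** With f the gradient of log n, the Christoffel symbols of a conformal metric are delta_ki f_j +
    delta_kj f_i - delta_ij f_k. The off-diagonal components are constant, so their derivatives drop
    out. *)
Lemma optical_acceleration (n : R -> R) (p w : plane) :
  riemannian_metric (optical_metric n) ->
  - sum_axis (fun i => sum_axis (fun j =>
      christoffel (optical_metric n) X1 i j p * coord i w * coord j w))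
  = lgrad1 n (fst p) (snd p) * (snd w ^ 2 - fst w ^ 2)
    - 2 * lgrad2 n (fst p) (snd p) * (fst w * snd w) /\
  - sum_axis (fun i => sum_axis (fun j =>
      christoffel (optical_metric n) X2 i j p * coord i w * coord j w))
  = lgrad2 n (fst p) (snd p) * (fst w ^ 2 - snd w ^ 2)
    - 2 * lgrad1 n (fst p) (snd p) * (fst w * snd w).
Proof.
  intros Hg. destruct p as [x y], w as [u v].
  pose proof (factor_pos n x y Hg) as Hpos.
  unfold sum_axis, christoffel, sum_axis, ginv, gdet, partial, optical_metric, lgrad1, lgrad2.
  cbn [coord fst snd]. rewrite !Derive_const.
  change (fun t => n (enorm (t, y)) ^ 2) with (fun t => factor n t y).
  change (fun t => n (enorm (x, t)) ^ 2) with (fun t => factor n x t).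
  change (n (enorm (x, y)) ^ 2) with (factor n x y).
  split; field; lra.
Qed.

Lemma geodesic_conformal_flow (n : R -> R) (a b : R) (c : R -> plane) :
  riemannian_metric (optical_metric n) -> geodesic_on (optical_metric n) a b c ->
  conformal_flow (lgrad1 n) (lgrad2 n) a b (fun t => fst (c t)) (fun t => snd (c t))
    (fun t => fst (velocity c t)) (fun t => snd (velocity c t)).
Proof.
  intros Hg H t Ht.
  destruct (optical_acceleration n (c t) (velocity c t) Hg) as [E1 E2].
  destruct (H t Ht X1) as [D1 A1], (H t Ht X2) as [D2 A2].
  rewrite E1 in A1. rewrite E2 in A2.
  split; [now apply Derive_correct|]. split; [now apply Derive_correct|].
  now split.
Qed.

(** This converse shows a transformed curve to be a geodesic from a candidate velocity. The
    candidate agrees with [velocity c] only on the open interval, so its derivative is transferred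
    locally. *)
Lemma conformal_flow_geodesic (n : R -> R) (a b : R) (c : R -> plane) (u v : R -> R) :
  riemannian_metric (optical_metric n) ->
  conformal_flow (lgrad1 n) (lgrad2 n) a b
    (fun t => fst (c t)) (fun t => snd (c t)) u v ->
  geodesic_on (optical_metric n) a b c /\
  forall t, a < t < b -> velocity c t = (u t, v t).
Proof.
  intros Hg H.
  assert (Hv : forall t, a < t < b -> velocity c t = (u t, v t)).
  { intros t Ht. destruct (H t Ht) as (dx & dy & _). unfold velocity; simpl.
    f_equal; now apply is_derive_unique. }
  split; [| exact Hv]. intros t Ht k.
  destruct (optical_acceleration n (c t) (velocity c t) Hg) as [E1 E2].
  rewrite (Hv t Ht) in *. destruct (H t Ht) as (dx & dy & du & dv).
  assert (Hloc : locally t (fun s => a < s < b)).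
  { apply filter_and; [now apply (open_gt a) | now apply (open_lt b)]. }
  destruct k; (split; [eexists; eassumption|]).
  - eapply (is_derive_ext_loc u).
    + revert Hloc; apply filter_imp; intros s Hs. now rewrite (Hv s Hs).
    + rewrite E1. exact du.
  - eapply (is_derive_ext_loc v).
    + revert Hloc; apply filter_imp; intros s Hs. now rewrite (Hv s Hs).
    + rewrite E2. exact dv.
Qed.

Lemma geodesic_unique (n : R -> R) (a b a' b' : R) (c c' : R -> plane) :
  riemannian_metric (optical_metric n) -> a < 0 -> a' < 0 ->
  geodesic_on (optical_metric n) a b c -> geodesic_on (optical_metric n) a' b' c' ->
  c 0 = c' 0 -> velocity c 0 = velocity c' 0 ->
  forall t, 0 <= t -> t < b -> t < b' -> c t = c' t.
Proof.
  intros Hg Ha Ha' H H' Hc Hv t H0 Hb Hb'.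
  destruct (lgrad_locally_lipschitz n Hg) as [L1 L2].
  apply injective_projections;
    eapply (conformal_flow_unique _ _ a b a' b' _ _ _ _ _ _ _ _ L1 L2 Ha Ha'
      (geodesic_conformal_flow n a b c Hg H)
      (geodesic_conformal_flow n a' b' c' Hg H')); auto; now f_equal.
Qed.

(** * Dilations of time and rotations act on geodesics *)

Lemma is_derive_eq (f : R -> R) (t l l' : R) :
  is_derive f t l -> l = l' -> is_derive f t l'.
Proof. intros H <-. exact H. Qed.

Lemma is_derive_lincomb (f h : R -> R) (t p q lf lh : R) :
  is_derive f t lf -> is_derive h t lh ->
  is_derive (fun s => p * f s + q * h s) t (p * lf + q * lh).
Proof.
  intros Hf Hh.
  apply (is_derive_plus (K := R_AbsRing) (V := R_NormedModule));
    now apply (is_derive_scal (fun s => _)).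
Qed.

Lemma is_derive_dilation (f : R -> R) (k t lf : R) :
  is_derive f (k * t) lf -> is_derive (fun s => f (k * s)) t (k * lf).
Proof.
  intros Hf.
  apply (is_derive_comp (K := R_AbsRing) (V := R_NormedModule) f (fun s => k * s));
    [exact Hf|]. auto_derive; [trivial | ring].
Qed.

(** The acceleration is homogeneous of degree two in the velocity, so both sides of the geodesic
    equation scale by [k] squared. *)
Lemma geodesic_dilation (n : R -> R) (a b k : R) (c : R -> plane) :
  riemannian_metric (optical_metric n) -> 0 < k ->
  geodesic_on (optical_metric n) a b c ->
  geodesic_on (optical_metric n) (a / k) (b / k) (fun t => c (k * t)) /\
  (forall t, a < k * t < b ->
     velocity (fun s => c (k * s)) t = vscale k (velocity c (k * t))).
Proof.
  intros Hg Hk H. apply geodesic_conformal_flow in H as F; [| exact Hg].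
  assert (Hdom : forall t, a / k < t < b / k <-> a < k * t < b).
  { intros t. rewrite (Rmult_comm k), Rlt_div_l, Rlt_div_r; tauto. }
  destruct (conformal_flow_geodesic n (a / k) (b / k) (fun t => c (k * t))
    (fun t => k * fst (velocity c (k * t))) (fun t => k * snd (velocity c (k * t))) Hg)
    as [G V].
  { intros t Ht. apply Hdom in Ht. destruct (F _ Ht) as (dx & dy & du & dv).
    apply is_derive_dilation in dx, dy, du, dv.
    apply (is_derive_scal _ _ k) in du, dv.
    split; [exact dx|]. split; [exact dy|].
    split; evar_last; try eassumption; simpl; ring. }
  split; [exact G|]. intros t Ht. apply V. now apply Hdom.
Qed.

Definition rotate (phi : R) (p : plane) : plane :=
  (cos phi * fst p - sin phi * snd p, sin phi * fst p + cos phi * snd p).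

Lemma sin2_cos2_pow (phi : R) : sin phi ^ 2 + cos phi ^ 2 = 1.
Proof. rewrite <- (sin2_cos2 phi). unfold Rsqr. ring. Qed.

Lemma enorm_rotate (phi : R) (p : plane) : enorm (rotate phi p) = enorm p.
Proof.
  unfold enorm, rotate; cbn [fst snd]. f_equal.
  transitivity ((sin phi ^ 2 + cos phi ^ 2) * (fst p ^ 2 + snd p ^ 2));
    [ring | rewrite sin2_cos2_pow; ring].
Qed.

Lemma factor_rotate (n : R -> R) (phi x y : R) :
  factor n (cos phi * x - sin phi * y) (sin phi * x + cos phi * y) = factor n x y.
Proof. unfold factor. f_equal. f_equal. exact (enorm_rotate phi (x, y)). Qed.

Lemma factor_chain_rule (n : R -> R) (x y : R -> R) (t lx ly : R) :
  riemannian_metric (optical_metric n) -> is_derive x t lx -> is_derive y t ly ->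
  is_derive (fun s => factor n (x s) (y s)) t
    (Derive (fun z => factor n z (y t)) (x t) * lx
     + Derive (fun z => factor n (x t) z) (y t) * ly).
Proof.
  intros Hg Hx Hy. apply is_derive_Reals. apply derivable_pt_lim_comp_2d.
  - apply C1_differentiable. intros; now apply factor_smooth.
  - now apply is_derive_Reals.
  - now apply is_derive_Reals.
Qed.

(** Differentiating the invariance [factor_rotate] in [x] and in [y] expresses the gradient at the
    original point by the one at the rotated point; inverting this orthogonal relation gives the
    claim. *)
Lemma lgrad_rotate (n : R -> R) (phi x y : R) :
  riemannian_metric (optical_metric n) ->
  lgrad1 n (cos phi * x - sin phi * y) (sin phi * x + cos phi * y)
  = cos phi * lgrad1 n x y - sin phi * lgrad2 n x y /\
  lgrad2 n (cos phi * x - sin phi * y) (sin phi * x + cos phi * y)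
  = sin phi * lgrad1 n x y + cos phi * lgrad2 n x y.
Proof.
  intros Hg.
  assert (H1 := factor_chain_rule n (fun z => cos phi * z - sin phi * y)
    (fun z => sin phi * z + cos phi * y) x (cos phi) (sin phi) Hg
    ltac:(auto_derive; [trivial | ring]) ltac:(auto_derive; [trivial | ring])).
  assert (H2 := factor_chain_rule n (fun z => cos phi * x - sin phi * z)
    (fun z => sin phi * x + cos phi * z) y (- sin phi) (cos phi) Hg
    ltac:(auto_derive; [trivial | ring]) ltac:(auto_derive; [trivial | ring])).
  apply (is_derive_ext _ (fun z => factor n z y)) in H1;
    [| intros; apply factor_rotate].
  apply (is_derive_ext _ (fun z => factor n x z)) in H2;
    [| intros; apply factor_rotate].
  apply is_derive_unique in H1, H2. cbv beta in H1, H2.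
  unfold lgrad1, lgrad2. rewrite factor_rotate.
  rewrite (H1 : Derive (fun z : R => factor n z y) x = _).
  rewrite (H2 : Derive (fun z : R => factor n x z) y = _).
  set (d1 := Derive _ (cos phi * x - sin phi * y)).
  set (d2 := Derive _ (sin phi * x + cos phi * y)).
  set (k := / factor n x y * / 2). pose proof (sin2_cos2_pow phi) as Hsc.
  split.
  - transitivity (d1 * k * (sin phi ^ 2 + cos phi ^ 2)); [rewrite Hsc|]; ring.
  - transitivity (d2 * k * (sin phi ^ 2 + cos phi ^ 2)); [rewrite Hsc|]; ring.
Qed.

(** The derivative of [factor_rotate] in the angle at 0: the gradient is parallel to the position,
    so the force has no torque about the origin. *)
Lemma lgrad_radial (n : R -> R) (x y : R) :
  riemannian_metric (optical_metric n) -> x * lgrad2 n x y = y * lgrad1 n x y.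
Proof.
  intros Hg.
  assert (H := factor_chain_rule n (fun z => cos z * x - sin z * y)
    (fun z => sin z * x + cos z * y) 0 (- y) x Hg
    ltac:(auto_derive; [trivial | rewrite cos_0, sin_0; ring])
    ltac:(auto_derive; [trivial | rewrite cos_0, sin_0; ring])).
  apply (is_derive_ext _ (fun _ => factor n x y)) in H;
    [| intros; apply factor_rotate].
  apply is_derive_unique in H. rewrite Derive_const, cos_0, sin_0 in H.
  replace (1 * x - 0 * y) with x in H by ring.
  replace (0 * x + 1 * y) with y in H by ring.
  unfold lgrad1, lgrad2.
  set (d1 := Derive _ x) in *. set (d2 := Derive _ y) in *.
  set (k := / factor n x y * / 2).
  transitivity (y * (d1 * k) + (d1 * - y + d2 * x) * k); [ring | rewrite <- H; ring].
Qed.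

Lemma geodesic_rotate (n : R -> R) (a b phi : R) (c : R -> plane) :
  riemannian_metric (optical_metric n) ->
  geodesic_on (optical_metric n) a b c ->
  geodesic_on (optical_metric n) a b (fun t => rotate phi (c t)) /\
  (forall t, a < t < b ->
     velocity (fun t => rotate phi (c t)) t = rotate phi (velocity c t)).
Proof.
  intros Hg H. apply geodesic_conformal_flow in H as F; [| exact Hg].
  apply (conformal_flow_geodesic n a b (fun t => rotate phi (c t))
    (fun t => fst (rotate phi (velocity c t)))
    (fun t => snd (rotate phi (velocity c t))) Hg).
  intros t Ht. destruct (F _ Ht) as (dx & dy & du & dv).
  unfold rotate; cbn [fst snd].
  destruct (lgrad_rotate n phi (fst (c t)) (snd (c t)) Hg) as [E1 E2].
  rewrite E1, E2.
  set (f1 := lgrad1 n _ _) in *. set (f2 := lgrad2 n _ _) in *.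
  set (u := fst (velocity c t)) in *. set (v := snd (velocity c t)) in *.
  pose proof (sin2_cos2_pow phi) as Hsc.
  assert (Hext : forall f h : R -> R, forall l,
    is_derive (fun s => cos phi * f s + - sin phi * h s) t l ->
    is_derive (fun s => cos phi * f s - sin phi * h s) t l).
  { intros f h l Hl. eapply is_derive_ext; [| exact Hl]. intros; simpl; ring. }
  split; [| split; [| split]].
  - apply Hext. eapply is_derive_eq; [apply is_derive_lincomb; eassumption | ring].
  - eapply is_derive_eq; [apply is_derive_lincomb; eassumption | ring].
  - apply Hext. eapply is_derive_eq; [apply is_derive_lincomb; eassumption |].
    (* The rotated acceleration is cubic in cos and sin, through one gradient and two velocities,
       while the rotation of the acceleration is linear; the missing factor is sin^2 + cos^2. *)
    transitivity ((sin phi ^ 2 + cos phi ^ 2) *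
      (cos phi * (f1 * (v ^ 2 - u ^ 2) - 2 * f2 * (u * v))
       + - sin phi * (f2 * (u ^ 2 - v ^ 2) - 2 * f1 * (u * v))));
      [rewrite Hsc|]; ring.
  - eapply is_derive_eq; [apply is_derive_lincomb; eassumption |].
    transitivity ((sin phi ^ 2 + cos phi ^ 2) *
      (sin phi * (f1 * (v ^ 2 - u ^ 2) - 2 * f2 * (u * v))
       + cos phi * (f2 * (u ^ 2 - v ^ 2) - 2 * f1 * (u * v))));
      [rewrite Hsc|]; ring.
Qed.

(** * Conservation of energy and angular momentum *)

Definition cross (v w : plane) : R := fst v * snd w - snd v * fst w.

(** For the energy, the growth of n^2 along the curve cancels the change of the squared Euclidean
    speed. The angular momentum has derivative n^2 |c'|^2 (x f2 - y f1), with (f1, f2) the gradient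
    of log n, and this vanishes by [lgrad_radial]. *)
Lemma geodesic_conservation (n : R -> R) (a b s t : R) (c : R -> plane) :
  riemannian_metric (optical_metric n) ->
  geodesic_on (optical_metric n) a b c -> a < s -> s <= t -> t < b ->
  factor n (fst (c s)) (snd (c s)) * dot (velocity c s) (velocity c s)
  = factor n (fst (c t)) (snd (c t)) * dot (velocity c t) (velocity c t) /\
  factor n (fst (c s)) (snd (c s)) * cross (c s) (velocity c s)
  = factor n (fst (c t)) (snd (c t)) * cross (c t) (velocity c t).
Proof.
  intros Hg H Has [Hst | ->] Htb; [| tauto].
  apply geodesic_conformal_flow in H; [| exact Hg]. revert H. unfold dot, cross.
  set (u := fun r => fst (velocity c r)). set (v := fun r => snd (velocity c r)).
  set (x := fun r => fst (c r)). set (y := fun r => snd (c r)). intros H.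
  assert (dN : forall r, a < r < b -> is_derive (fun r => factor n (x r) (y r)) r
    (2 * factor n (x r) (y r)
     * (lgrad1 n (x r) (y r) * u r + lgrad2 n (x r) (y r) * v r))).
  { intros r Hr. destruct (H r Hr) as (dx & dy & _).
    eapply is_derive_eq; [now apply factor_chain_rule; [| apply dx | apply dy]|].
    pose proof (factor_pos n (x r) (y r) Hg). unfold lgrad1, lgrad2. field. lra. }
  assert (dM : forall (f h : R -> R) r lf lh, is_derive f r lf -> is_derive h r lh ->
    is_derive (fun r => f r * h r) r (lf * h r + f r * lh)).
  { intros. apply (is_derive_mult (K := R_AbsRing) f h); auto. intros; apply Rmult_comm. }
  assert (dP : forall (f h : R -> R) r lf lh, is_derive f r lf -> is_derive h r lh ->
    is_derive (fun r => f r + h r) r (lf + lh)).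
  { intros. now apply (is_derive_plus (K := R_AbsRing) (V := R_NormedModule)). }
  assert (dB : forall (f h : R -> R) r lf lh, is_derive f r lf -> is_derive h r lh ->
    is_derive (fun r => f r - h r) r (lf - lh)).
  { intros. now apply (is_derive_minus (K := R_AbsRing) (V := R_NormedModule)). }
  split.
  - apply (eq_is_derive (V := R_NormedModule)
      (fun r => factor n (x r) (y r) * (u r * u r + v r * v r)) s t); [| exact Hst].
    intros r Hr. assert (Hr' : a < r < b) by lra.
    destruct (H r Hr') as (dx & dy & du & dv). specialize (dN r Hr').
    eapply is_derive_eq; [apply dM; [exact dN | apply dP; apply dM; eassumption]|].
    change zero with 0; cbv beta. ring.
  - apply (eq_is_derive (V := R_NormedModule)
      (fun r => factor n (x r) (y r) * (x r * v r - y r * u r)) s t); [| exact Hst].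
    intros r Hr. assert (Hr' : a < r < b) by lra.
    destruct (H r Hr') as (dx & dy & du & dv). specialize (dN r Hr').
    eapply is_derive_eq; [apply dM; [exact dN | apply dB; apply dM; eassumption]|].
    change zero with 0; cbv beta. pose proof (lgrad_radial n (x r) (y r) Hg) as Hrad.
    set (f1 := lgrad1 n _ _) in *. set (f2 := lgrad2 n _ _) in *.
    transitivity (factor n (x r) (y r) * (u r ^ 2 + v r ^ 2)
      * (x r * f2 - y r * f1)); [ring | rewrite Hrad; ring].
Qed.
(** * The boundary circle *)

Lemma unit_vector_angle (x y : R) :
  x ^ 2 + y ^ 2 = 1 ->
  exists theta, 0 <= theta <= 2 * PI /\ x = cos theta /\ y = sin theta.
Proof.
  intros H. assert (Hx : -1 <= x <= 1) by nra.
  assert (Hs : sqrt (1 - Rsqr x) = Rabs y).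
  { rewrite <- sqrt_Rsqr_abs. f_equal. unfold Rsqr. nra. }
  pose proof (acos_bound x). pose proof PI_RGT_0.
  destruct (Rle_or_lt 0 y) as [Hy | Hy].
  - exists (acos x). rewrite cos_acos, sin_acos, Hs by lra.
    rewrite Rabs_pos_eq; auto. lra.
  - exists (- acos x + 2 * PI).
    rewrite cos_plus, sin_plus, cos_2PI, sin_2PI, cos_neg, sin_neg,
      cos_acos, sin_acos, Hs by lra.
    rewrite Rabs_left by lra. lra.
Qed.

(** The hypotheses give cos (s - t) = 1, and the half angle turns this into a zero of sine, an
    integer multiple of PI. *)
Lemma cos_sin_eq_mod_2PI (s t : R) :
  cos s = cos t -> sin s = sin t -> exists k : Z, s = t + IZR k * (2 * PI).
Proof.
  intros Hc Hs.
  assert (H1 : cos (s - t) = 1).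
  { rewrite cos_minus, Hc, Hs. pose proof (sin2_cos2_pow t). lra. }
  assert (H0 : sin ((s - t) / 2) = 0).
  { replace (s - t) with (2 * ((s - t) / 2)) in H1 by field.
    rewrite cos_2a_sin in H1. nra. }
  destruct (sin_eq_0_0 _ H0) as [k Hk]. exists k. lra.
Qed.

Lemma periodic_Z {A : Type} (f : R -> A) (T : R) :
  (forall t, f (t + T) = f t) -> forall (k : Z) t, f (t + IZR k * T) = f t.
Proof.
  intros H k. induction k as [| k IH | k IH] using Z.peano_ind; intros t.
  - f_equal. ring.
  - rewrite <- (IH t), <- (H (t + IZR k * T)), succ_IZR. f_equal. ring.
  - unfold Z.pred. rewrite plus_IZR, <- (IH t), <- H. f_equal. ring.
Qed.

Lemma ginner_optical (n : R -> R) (p v w : plane) :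
  ginner (optical_metric n) p v w = factor n (fst p) (snd p) * dot v w.
Proof.
  destruct p as [x y]. unfold ginner, sum_axis, optical_metric, factor, dot.
  cbn [coord fst snd]. ring.
Qed.

Lemma dot_rotate (phi : R) (v w : plane) : dot (rotate phi v) (rotate phi w) = dot v w.
Proof.
  unfold dot, rotate; cbn [fst snd].
  transitivity ((sin phi ^ 2 + cos phi ^ 2) * (fst v * fst w + snd v * snd w));
    [ring | rewrite sin2_cos2_pow; ring].
Qed.

Lemma rotate_origin (phi : R) : rotate phi (0, 0) = (0, 0).
Proof. unfold rotate; simpl. f_equal; ring. Qed.

Lemma rotate_polar (phi theta r : R) :
  rotate phi (r * cos theta, r * sin theta)
  = (r * cos (theta + phi), r * sin (theta + phi)).
Proof. unfold rotate; simpl. rewrite cos_plus, sin_plus. f_equal; ring. Qed.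

Lemma exp_map_origin_rotate (n : R -> R) (phi : R) (v p : plane) :
  riemannian_metric (optical_metric n) ->
  exp_map (optical_metric n) (0, 0) v p ->
  exp_map (optical_metric n) (0, 0) (rotate phi v) (rotate phi p).
Proof.
  intros Hg (a & b & c & Ha & Hb & H & H0 & Hv & H1).
  destruct (geodesic_rotate n a b phi c Hg H) as [G V].
  exists a, b, (fun t => rotate phi (c t)).
  rewrite V, H0, Hv, H1, rotate_origin by lra. tauto.
Qed.

(** Rotations about the origin preserve the geodesic circle, so turning [gamma 0] by [theta] gives a
    point of the trace. Its polar angle is [theta], and a curve parametrized by the polar angle has
    no other point there than [gamma theta]. *)
Lemma polar_geodesic_circle (n : R -> R) (gamma : R -> plane) (rho : R) :
  riemannian_metric (optical_metric n) -> polar_parametrization gamma ->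
  geodesic_circle (optical_metric n) (0, 0) rho (trace gamma) ->
  exists r, 0 < r /\ forall theta, gamma theta = (r * cos theta, r * sin theta).
Proof.
  intros Hg [Hper Hpol] (_ & _ & Hcirc).
  destruct (Hpol 0) as (r & Hr & H0). exists r. split; [exact Hr|]. intros theta.
  destruct (proj1 (Hcirc (gamma 0)) (ex_intro _ 0 eq_refl)) as (v & Hv & He).
  assert (Ht : trace gamma (rotate theta (gamma 0))).
  { apply Hcirc. exists (rotate theta v). split; [| now apply exp_map_origin_rotate].
    rewrite <- Hv. unfold gnorm. now rewrite !ginner_optical, dot_rotate. }
  rewrite H0, rotate_polar, Rplus_0_l in Ht. destruct Ht as [theta' Ht].
  destruct (Hpol theta') as (r' & Hr' & H'). rewrite H' in Ht.
  pose proof (f_equal fst Ht) as E1. pose proof (f_equal snd Ht) as E2.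
  cbn [fst snd] in E1, E2.
  assert (r' = r).
  { apply Rsqr_inj; [lra | lra |]. unfold Rsqr.
    transitivity ((r' * cos theta') ^ 2 + (r' * sin theta') ^ 2).
    - transitivity (r' * r' * (sin theta' ^ 2 + cos theta' ^ 2)); [| ring].
      rewrite sin2_cos2_pow. ring.
    - rewrite E1, E2.
      transitivity (r * r * (sin theta ^ 2 + cos theta ^ 2)); [ring |].
      rewrite sin2_cos2_pow. ring. }
  subst r'. apply Rmult_eq_reg_l in E1; [| lra]. apply Rmult_eq_reg_l in E2; [| lra].
  destruct (cos_sin_eq_mod_2PI theta' theta E1 E2) as [k ->].
  rewrite (periodic_Z gamma (2 * PI) Hper) in H'. now rewrite H', E1, E2.
Qed.

Definition circle_param (r : R) (gamma : R -> plane) : Prop :=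
  0 < r /\ forall theta, gamma theta = (r * cos theta, r * sin theta).

Lemma circle_tangent (r : R) (gamma : R -> plane) (theta : R) :
  circle_param r gamma -> tangent gamma theta = (- sin theta, cos theta).
Proof.
  intros [Hr H].
  assert (Hv : velocity gamma theta = (- (r * sin theta), r * cos theta)).
  { unfold velocity. f_equal; simpl.
    - rewrite (Derive_ext _ (fun s => r * cos s)) by (intros; now rewrite H).
      apply is_derive_unique. auto_derive; [trivial | ring].
    - rewrite (Derive_ext _ (fun s => r * sin s)) by (intros; now rewrite H).
      apply is_derive_unique. auto_derive; [trivial | ring]. }
  unfold tangent. rewrite Hv. unfold enorm, vscale; cbn [fst snd].
  replace ((- (r * sin theta)) ^ 2 + (r * cos theta) ^ 2) with (r * r)
    by (transitivity (r * r * (sin theta ^ 2 + cos theta ^ 2));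
        [rewrite sin2_cos2_pow |]; ring).
  rewrite sqrt_square by lra. f_equal; field; lra.
Qed.

Lemma circle_direction (r : R) (gamma : R -> plane) (theta alpha : R) :
  circle_param r gamma ->
  direction gamma theta alpha
  = (- cos alpha * sin theta - sin alpha * cos theta,
     cos alpha * cos theta - sin alpha * sin theta).
Proof.
  intros H. unfold direction. rewrite (circle_tangent r) by assumption.
  cbn [fst snd]. f_equal; ring.
Qed.

Lemma circle_trace (r : R) (gamma : R -> plane) (p : plane) :
  circle_param r gamma -> trace gamma p <-> dot p p = r ^ 2.
Proof.
  intros [Hr H]. unfold trace, dot. split.
  - intros [theta <-]. rewrite H; cbn [fst snd].
    transitivity (r ^ 2 * (sin theta ^ 2 + cos theta ^ 2)); [ring|].
    rewrite sin2_cos2_pow. ring.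
  - intros Hp. destruct (unit_vector_angle (fst p / r) (snd p / r)) as (theta & _ & Hc & Hs).
    + transitivity ((fst p * fst p + snd p * snd p) / r ^ 2); [| rewrite Hp]; field; lra.
    + exists theta. rewrite H, <- Hc, <- Hs.
      apply injective_projections; cbn [fst snd]; field; lra.
Qed.

Lemma disk_closed_region (r : R) (gamma : R -> plane) (p : plane) :
  circle_param r gamma -> dot p p <= r ^ 2 -> closed_region gamma p.
Proof.
  intros [Hr H] Hp. unfold dot in Hp.
  assert (Hs : sqrt (fst p * fst p + snd p * snd p) <= r).
  { rewrite <- (sqrt_pow2 r) by lra. now apply sqrt_le_1_alt. }
  destruct (Req_dec (fst p * fst p + snd p * snd p) 0) as [H0 | H0].
  - exists 0, 0. split; [lra|]. rewrite !Rmult_0_l.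
    apply injective_projections; cbn [fst snd]; nra.
  - assert (Hpos : 0 < fst p * fst p + snd p * snd p)
      by (pose proof (pow2_ge_0 (fst p)); pose proof (pow2_ge_0 (snd p)); lra).
    set (s := sqrt (fst p * fst p + snd p * snd p)) in *.
    assert (Hs0 : 0 < s) by now apply sqrt_lt_R0.
    assert (Hss : s * s = fst p * fst p + snd p * snd p) by (apply sqrt_sqrt; lra).
    destruct (unit_vector_angle (fst p / s) (snd p / s)) as (theta & _ & Hc & Hsn).
    { transitivity ((fst p * fst p + snd p * snd p) / (s * s)); [field; lra |].
      rewrite <- Hss. field. lra. }
    exists (s / r), theta. split.
    + split; [apply Rlt_le, Rdiv_lt_0_compat; lra|].
      apply (Rmult_le_reg_r r); [lra|]. field_simplify; lra.
    + rewrite H, <- Hc, <- Hsn.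
      apply injective_projections; cbn [fst snd]; field; lra.
Qed.

(** * The billiard map *)

Lemma cos_inj_0_PI (s t : R) : 0 < s < PI -> 0 < t < PI -> cos s = cos t -> s = t.
Proof.
  intros Hs Ht H. rewrite <- (acos_cos s), <- (acos_cos t) by lra. now rewrite H.
Qed.

(* Conservation of energy and of angular momentum between two points of the
   circle, where the conformal factor takes the same value. *)
Lemma geodesic_return_invariants (n : R -> R) (r a b t l alpha theta : R)
  (gamma c : R -> plane) :
  riemannian_metric (optical_metric n) -> circle_param r gamma ->
  geodesic_on (optical_metric n) a b c -> a < 0 -> 0 < t < b ->
  c 0 = gamma theta -> velocity c 0 = vscale l (direction gamma theta alpha) ->
  trace gamma (c t) ->
  dot (velocity c t) (velocity c t) = l ^ 2 /\
  cross (c t) (velocity c t) = r * l * cos alpha.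
Proof.
  intros Hg Hc H Ha Ht H0 Hv H1.
  destruct (geodesic_conservation n a b 0 t c Hg H) as [HE HL]; try lra.
  assert (HN : factor n (fst (c 0)) (snd (c 0)) = factor n (fst (c t)) (snd (c t))).
  { assert (H0' : trace gamma (c 0)) by (exists theta; auto).
    apply (circle_trace r) in H0', H1; auto. unfold dot in H0', H1.
    unfold factor, enorm. cbn [fst snd]. do 3 f_equal. lra. }
  pose proof (factor_pos n (fst (c t)) (snd (c t)) Hg) as HNpos.
  rewrite HN in HE, HL.
  apply Rmult_eq_reg_l in HE; [| lra]. apply Rmult_eq_reg_l in HL; [| lra].
  rewrite <- HE, <- HL, H0, Hv, (circle_direction r) by assumption.
  rewrite (proj2 Hc). unfold dot, cross, vscale; cbn [fst snd].
  pose proof (sin2_cos2_pow theta) as E1. pose proof (sin2_cos2_pow alpha) as E2.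
  split.
  - transitivity (l ^ 2 * ((sin theta ^ 2 + cos theta ^ 2)
                           * (sin alpha ^ 2 + cos alpha ^ 2))); [ring|].
    rewrite E1, E2. ring.
  - transitivity (r * l * cos alpha * (sin theta ^ 2 + cos theta ^ 2)); [ring|].
    rewrite E1. ring.
Qed.

Lemma reflect_isometry (u w : plane) :
  dot u u = 1 ->
  dot u (reflect u w) = dot u w /\ dot (reflect u w) (reflect u w) = dot w w.
Proof.
  intros H. assert (E : dot u (reflect u w) = dot u w).
  { unfold reflect. transitivity (dot u w * (2 * dot u u - 1)); [| rewrite H; ring].
    unfold dot; cbn [fst snd]. ring. }
  split; [exact E|].
  transitivity (4 * dot u w ^ 2 * (dot u u - 1) + dot w w); [| rewrite H; ring].
  unfold reflect, dot; cbn [fst snd]. ring.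
Qed.

Lemma state_eq (theta theta' alpha alpha' : R) :
  state theta alpha = state theta' alpha' <->
  cos theta = cos theta' /\ sin theta = sin theta' /\ alpha = alpha'.
Proof.
  unfold state. split.
  - intros E. repeat split.
    + exact (f_equal (fun s => fst (fst s)) E).
    + exact (f_equal (fun s => snd (fst s)) E).
    + exact (f_equal snd E).
  - intros (-> & -> & ->). reflexivity.
Qed.

(** Reflection keeps the length and the tangential component. Energy then gives [m = l], angular
    momentum gives equal cosines, and cosine is injective on the open interval. *)
Lemma billiard_step_angle (n : R -> R) (r : R) (gamma : R -> plane) (s s' : phase) :
  riemannian_metric (optical_metric n) -> circle_param r gamma ->
  billiard_step n gamma s s' -> snd s' = snd s.
Proof.
  intros Hg Hc (th0 & al0 & th1 & al1 & -> & Hal0 & -> & Hal1 &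
    a & b & t1 & l & m & c & Ha & Ht1 & Hl & Hm & H & H0 & Hv & _ & H1 & Hr).
  cbn [state snd].
  destruct (geodesic_return_invariants n r a b t1 l al0 th0 gamma c) as [HE HL];
    try assumption; [now exists th1|].
  assert (Hu : dot (tangent gamma th1) (tangent gamma th1) = 1).
  { rewrite (circle_tangent r) by assumption. unfold dot; cbn [fst snd].
    rewrite <- (sin2_cos2_pow th1). ring. }
  destruct (reflect_isometry _ (velocity c t1) Hu) as [R1 R2].
  rewrite Hr in R1, R2. rewrite HE in R2.
  rewrite H1, (proj2 Hc) in HL. unfold cross in HL; cbn [fst snd] in HL.
  rewrite (circle_direction r) in R1, R2 by assumption.
  rewrite (circle_tangent r) in R1 by assumption.
  unfold dot, vscale in R1, R2; cbn [fst snd] in R1, R2.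
  assert (Hml : m = l).
  { apply Rsqr_inj; [lra | lra |]. unfold Rsqr.
    transitivity (m * m * ((sin th1 ^ 2 + cos th1 ^ 2) * (sin al1 ^ 2 + cos al1 ^ 2)));
      [rewrite !sin2_cos2_pow; ring | lra]. }
  assert (Hr0 : 0 < r) by apply Hc.
  assert (HC : m * cos al1 * (sin th1 ^ 2 + cos th1 ^ 2) = l * cos al0).
  { apply (Rmult_eq_reg_l r); [| lra].
    transitivity (r * (- sin th1 * fst (velocity c t1) + cos th1 * snd (velocity c t1)));
      [rewrite <- R1; ring | lra]. }
  rewrite sin2_cos2_pow, Hml, Rmult_1_r in HC. apply Rmult_eq_reg_l in HC; [| lra].
  now apply cos_inj_0_PI.
Qed.

(** Running [c'] at the rate [l / l'] gives it the initial velocity of [c], so the two agree as long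
    as both are defined. If one reached the curve strictly earlier, the other would meet it before
    its own first return. *)
Lemma first_return_unique (n : R -> R) (gamma c c' : R -> plane) (w : plane)
  (a b t l a' b' t' l' : R) :
  riemannian_metric (optical_metric n) ->
  a < 0 -> 0 < t < b -> 0 < l -> geodesic_on (optical_metric n) a b c ->
  a' < 0 -> 0 < t' < b' -> 0 < l' -> geodesic_on (optical_metric n) a' b' c' ->
  c 0 = c' 0 -> velocity c 0 = vscale l w -> velocity c' 0 = vscale l' w ->
  (forall s, 0 < s < t -> ~ trace gamma (c s)) -> trace gamma (c t) ->
  (forall s, 0 < s < t' -> ~ trace gamma (c' s)) -> trace gamma (c' t') ->
  c t = c' t'.
Proof.
  intros Hg Ha Ht Hl H Ha' Ht' Hl' H' H0 Hv Hv' Hn H1 Hn' H1'.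
  set (k := l / l').
  assert (Hk : 0 < k) by now apply Rdiv_lt_0_compat.
  destruct (geodesic_dilation n a' b' k c' Hg Hk H') as [G V].
  assert (Hak : a' / k < 0) by (rewrite Rlt_div_l; lra).
  assert (Hu : forall s, 0 <= s -> s < b -> s < b' / k -> c s = c' (k * s)).
  { apply (geodesic_unique n a b (a' / k) (b' / k) c (fun s => c' (k * s)));
      try assumption; [now rewrite Rmult_0_r|].
    rewrite V by (rewrite Rmult_0_r; lra).
    rewrite Rmult_0_r, Hv, Hv'. unfold vscale, k; cbn [fst snd]. f_equal; field; lra. }
  assert (Htk : t' / k < b' / k).
  { unfold Rdiv. apply Rmult_lt_compat_r; [now apply Rinv_0_lt_compat | lra]. }
  assert (Htk0 : 0 < t' / k) by (apply Rdiv_lt_0_compat; lra).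
  assert (Hkk : k * (t' / k) = t') by (field; lra).
  destruct (Rtotal_order t (t' / k)) as [Hlt | [-> | Hgt]].
  - exfalso. apply (Hn' (k * t)).
    + split; [now apply Rmult_lt_0_compat|]. rewrite <- Hkk.
      now apply Rmult_lt_compat_l.
    + rewrite <- Hu; [assumption | lra | lra | lra].
  - rewrite Hu, Hkk by lra. reflexivity.
  - exfalso. apply (Hn (t' / k)); [lra|].
    rewrite Hu, Hkk by lra. assumption.
Qed.

Lemma billiard_step_unique (n : R -> R) (r : R) (gamma : R -> plane) (s s1 s2 : phase) :
  riemannian_metric (optical_metric n) -> circle_param r gamma ->
  billiard_step n gamma s s1 -> billiard_step n gamma s s2 -> s1 = s2.
Proof.
  intros Hg Hc B1 B2.
  apply injective_projections.
  2: { transitivity (snd s); [| symmetry]; eapply billiard_step_angle; eassumption. }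
  destruct B1 as (th0 & al0 & th1 & al1 & -> & Hal0 & -> & Hal1 &
    a & b & t1 & l & m & c & Ha & Ht1 & Hl & Hm & H & H0 & Hv & Hn & H1 & _).
  destruct B2 as (th0' & al0' & th1' & al1' & E & Hal0' & -> & Hal1' &
    a' & b' & t1' & l' & m' & c' & Ha' & Ht1' & Hl' & Hm' & H' & H0' & Hv' & Hn' & H1' & _).
  (* The two polar angles may differ by a multiple of 2 PI; only their cosine and sine matter for
     [gamma] and [direction]. *)
  apply state_eq in E. destruct E as (Ec & Es & <-).
  assert (E : c t1 = c' t1').
  { apply (first_return_unique n gamma c c' (direction gamma th0 al0)
             a b t1 l a' b' t1' l'); auto.
    - rewrite H0, H0', !(proj2 Hc), Ec, Es. reflexivity.
    - rewrite Hv', !(circle_direction r), Ec, Es by assumption. reflexivity.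
    - now exists th1.
    - now exists th1'. }
  rewrite H1, H1', !(proj2 Hc) in E. pose proof (proj1 Hc).
  unfold state; cbn [fst].
  apply injective_projections; cbn [fst snd]; apply (Rmult_eq_reg_l r); try lra.
  - exact (f_equal fst E).
  - exact (f_equal snd E).
Qed.

(** * Equivariance of the billiard under rotations *)

Definition rotate_phase (phi : R) (s : phase) : phase := (rotate phi (fst s), snd s).

Lemma rotate_state (phi theta alpha : R) :
  rotate_phase phi (state theta alpha) = state (theta + phi) alpha.
Proof.
  unfold rotate_phase, state, rotate; cbn [fst snd]. rewrite cos_plus, sin_plus.
  f_equal. f_equal; ring.
Qed.

Lemma rotate_direction (r : R) (gamma : R -> plane) (phi theta alpha : R) :
  circle_param r gamma ->
  rotate phi (direction gamma theta alpha) = direction gamma (theta + phi) alpha.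
Proof.
  intros Hc. rewrite !(circle_direction r) by assumption.
  unfold rotate; cbn [fst snd]. rewrite cos_plus, sin_plus. f_equal; ring.
Qed.

Lemma rotate_tangent (r : R) (gamma : R -> plane) (phi theta : R) :
  circle_param r gamma ->
  rotate phi (tangent gamma theta) = tangent gamma (theta + phi).
Proof.
  intros Hc. rewrite !(circle_tangent r) by assumption.
  unfold rotate; cbn [fst snd]. rewrite cos_plus, sin_plus. f_equal; ring.
Qed.

Lemma rotate_vscale (phi l : R) (v : plane) :
  rotate phi (vscale l v) = vscale l (rotate phi v).
Proof. unfold rotate, vscale; cbn [fst snd]. f_equal; ring. Qed.

Lemma rotate_reflect (phi : R) (u w : plane) :
  rotate phi (reflect u w) = reflect (rotate phi u) (rotate phi w).
Proof.
  unfold reflect. rewrite dot_rotate. unfold rotate; cbn [fst snd]. f_equal; ring.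
Qed.

Lemma billiard_step_rotate (n : R -> R) (r phi : R) (gamma : R -> plane) (s s' : phase) :
  riemannian_metric (optical_metric n) -> circle_param r gamma ->
  billiard_step n gamma s s' ->
  billiard_step n gamma (rotate_phase phi s) (rotate_phase phi s').
Proof.
  intros Hg Hc (th0 & al0 & th1 & al1 & -> & Hal0 & -> & Hal1 &
    a & b & t1 & l & m & c & Ha & Ht1 & Hl & Hm & H & H0 & Hv & Hn & H1 & Hr).
  destruct (geodesic_rotate n a b phi c Hg H) as [G V].
  exists (th0 + phi), al0, (th1 + phi), al1.
  split; [apply rotate_state|]. split; [exact Hal0|].
  split; [apply rotate_state|]. split; [exact Hal1|].
  exists a, b, t1, l, m, (fun t => rotate phi (c t)).
  do 5 (split; [assumption|]). split; [| split; [| split; [| split]]].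
  - rewrite H0, !(proj2 Hc). apply rotate_polar.
  - rewrite V, Hv, rotate_vscale, (rotate_direction r) by (assumption || lra). reflexivity.
  - intros t Ht Htr. apply (Hn t Ht). apply (circle_trace r) in Htr; [| assumption].
    rewrite dot_rotate in Htr. now apply (circle_trace r).
  - rewrite H1, !(proj2 Hc). apply rotate_polar.
  - rewrite V, <- (rotate_tangent r), <- rotate_reflect, Hr, rotate_vscale,
      (rotate_direction r) by (assumption || lra). reflexivity.
Qed.

(** * Existence of the first return *)

(** The first return time is the supremum of the times up to which [h] stays negative. Were [h]
    nonzero there, it would keep its sign nearby: negative, by comparison with earlier times, so
    negativity would extend past the supremum. *)
Lemma first_zero_after_descent (h : R -> R) (l T : R) :
  0 < T -> (forall t, 0 <= t <= T -> continuity_pt h t) ->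
  h 0 = 0 -> is_derive h 0 l -> l < 0 -> 0 < h T ->
  exists t1, 0 < t1 < T /\ h t1 = 0 /\ forall t, 0 < t < t1 -> h t < 0.
Proof.
  intros HT Hcont H0 Hd Hl HhT.
  assert (Hinit : exists eps, 0 < eps /\ forall t, 0 < t < eps -> h t < 0).
  (* The tolerance [- l] forces the difference quotients near 0 between 2 l and 0, hence
     negative. *)
  { apply is_derive_Reals in Hd. destruct (Hd (- l) ltac:(lra)) as [d Hd'].
    exists d. split; [apply cond_pos|]. intros t Ht.
    specialize (Hd' t ltac:(lra) ltac:(rewrite Rabs_right; lra)).
    rewrite Rplus_0_l, H0, Rminus_0_r in Hd'. apply Rabs_lt_between in Hd'.
    assert (E : h t = h t / t * t) by (field; lra). rewrite E. nra. }
  destruct Hinit as (eps & Heps & Hinit).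
  assert (HepsT : eps <= T).
  { apply Rnot_lt_le; intros Hlt. specialize (Hinit T). lra. }
  set (S := fun t => 0 <= t <= T /\ forall s, 0 < s <= t -> h s < 0).
  destruct (completeness S) as [t1 [Hub Hlub]].
  { exists T. intros t [Ht _]. lra. }
  { exists 0. split; [lra|]. intros; lra. }
  assert (HS : S (eps / 2)).
  { split; [lra|]. intros s Hs. apply Hinit; lra. }
  pose proof (Hub _ HS) as Ht1.
  assert (Ht1T : t1 <= T) by (apply Hlub; intros t [Ht _]; lra).
  assert (Hneg : forall t, 0 < t < t1 -> h t < 0).
  { intros t Ht. apply NNPP; intros Hn.
    assert (t1 <= t); [| lra]. apply Hlub. intros s [Hs1 Hs2].
    apply Rnot_lt_le; intros Hlt. apply Hn, Hs2; lra. }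
  assert (Hsign : h t1 <> 0 -> exists d : posreal,
    forall t, Rabs (t - t1) < d -> 0 < h t * h t1).
  { intros Hne. destruct (proj1 (continuity_pt_locally h t1)
      (Hcont t1 ltac:(lra)) (mkposreal _ (Rabs_pos_lt _ Hne))) as [d Hd'].
    exists d. intros t Ht. specialize (Hd' t Ht). cbn [pos] in Hd'.
    revert Hd'. unfold Rabs. repeat destruct Rcase_abs; intros; nra. }
  destruct (Req_dec (h t1) 0) as [Hz | Hne].
  { exists t1. repeat split; auto; [lra|].
    destruct Ht1T as [? | ->]; [assumption | lra]. }
  exfalso. destruct (Hsign Hne) as [d Hd']. pose proof (cond_pos d).
  set (e := Rmin (d / 2) (t1 / 2)).
  assert (He : 0 < e) by (apply Rmin_glb_lt; lra).
  assert (He1 : e <= d / 2) by apply Rmin_l.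
  assert (He2 : e <= t1 / 2) by apply Rmin_r.
  assert (Hn1 : h t1 < 0).
  { pose proof (Hneg (t1 - e) ltac:(lra)).
    specialize (Hd' (t1 - e) ltac:(rewrite Rabs_left; lra)). nra. }
  assert (Hlt : t1 < T) by (destruct Ht1T as [? | ->]; [assumption | lra]).
  (* Small enough for the sign of [h t1] to persist, and for [t1 + e'] not to exceed [T]. *)
  set (e' := Rmin (d / 2) (T - t1)).
  assert (He' : 0 < e') by (apply Rmin_glb_lt; lra).
  assert (He1' : e' <= d / 2) by apply Rmin_l.
  assert (He2' : e' <= T - t1) by apply Rmin_r.
  assert (HS' : S (t1 + e')).
  { split; [lra|]. intros s Hs. destruct (Rlt_or_le s t1); [apply Hneg; lra|].
    specialize (Hd' s ltac:(rewrite Rabs_right; lra)). nra. }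
  apply Hub in HS'. lra.
Qed.

(** Applied to the squared distance from the centre, this says that a first return reaches the
    circle from inside, with nonnegative radial velocity. *)
Lemma derivative_nonneg_from_left (h : R -> R) (l t1 : R) :
  0 < t1 -> is_derive h t1 l -> (forall t, 0 < t < t1 -> h t <= h t1) -> 0 <= l.
Proof.
  intros Ht1 Hd Hneg. apply Rnot_lt_le; intros Hl. apply is_derive_Reals in Hd.
  destruct (Hd (- l) ltac:(lra)) as [d Hd'].
  pose proof (cond_pos d). set (e := Rmin (d / 2) (t1 / 2)).
  assert (He : 0 < e) by (apply Rmin_glb_lt; lra).
  assert (He1 : e <= d / 2) by apply Rmin_l.
  assert (He2 : e <= t1 / 2) by apply Rmin_r.
  specialize (Hd' (- e) ltac:(lra) ltac:(rewrite Rabs_left; lra)).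
  specialize (Hneg (t1 + - e) ltac:(lra)).
  apply Rabs_lt_between in Hd'.
  assert (E : h (t1 + - e) - h t1 = (h (t1 + - e) - h t1) / - e * - e) by (field; lra).
  nra.
Qed.

Lemma gball_optical (n : R -> R) (q v : plane) (delta : R) :
  0 < delta ->
  gball (optical_metric n) q delta v <-> factor n (fst q) (snd q) * dot v v < delta ^ 2.
Proof.
  intros Hd. unfold gball, gnorm. rewrite ginner_optical.
  set (e := factor n (fst q) (snd q) * dot v v).
  assert (He : 0 <= e).
  { unfold e, factor, dot. pose proof (pow2_ge_0 (n (enorm (fst q, snd q)))).
    pose proof (Rle_0_sqr (fst v)). pose proof (Rle_0_sqr (snd v)). unfold Rsqr in *. nra. }
  rewrite <- (sqrt_pow2 delta) at 1 by lra.
  split; intros H; [now apply sqrt_lt_0_alt | apply sqrt_lt_1_alt; lra].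
Qed.

(* Otherwise [E] would send a whole radius of the open ball into the disk, and
   its inverse [G], bounded away from the boundary of the ball on the compact
   disk, could not recover the end of that radius. *)
Lemma geodesic_ray_leaves_disk (n : R -> R) (q w : plane) (delta r : R)
  (E : plane -> plane) :
  riemannian_metric (optical_metric n) -> 0 < delta -> 0 < r -> dot w w = 1 ->
  diffeomorphism_onto_image (gball (optical_metric n) q delta) E ->
  (forall p, dot p p <= r ^ 2 -> image (gball (optical_metric n) q delta) E p) ->
  exists l, 0 < l /\ gball (optical_metric n) q delta (vscale l w) /\
    r ^ 2 < dot (E (vscale l w)) (E (vscale l w)).
Proof.
  intros Hg Hd Hr Hw (_ & _ & G & HG & HGE) Hdisk.
  set (N := factor n (fst q) (snd q)).
  assert (HN : 0 < N) by now apply factor_pos.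
  apply NNPP; intros Hno.
  assert (Hin : forall l, 0 < l -> N * l ^ 2 < delta ^ 2 ->
    dot (E (vscale l w)) (E (vscale l w)) <= r ^ 2 /\ G (E (vscale l w)) = vscale l w).
  { intros l Hl Hlt.
    assert (Hb : gball (optical_metric n) q delta (vscale l w)).
    { apply gball_optical; [assumption|]. fold N.
      replace (dot (vscale l w) (vscale l w)) with (l ^ 2 * dot w w)
        by (unfold dot, vscale; cbn [fst snd]; ring).
      rewrite Hw, Rmult_1_r. exact Hlt. }
    split; [| now apply HGE].
    apply Rnot_lt_le; intros Hout. apply Hno. now exists l. }
  (* [/ M] is a gap between the squared length of [G] and [delta ^ 2]. The square exceeds the disk,
     hence the implication; off the closed disk it holds vacuously nearby. The clause [0 < M] makes
     the property monotone in [M]. *)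
  destruct (box_uniform_constant
    (fun x y M => 0 < M /\ (x ^ 2 + y ^ 2 <= r ^ 2 ->
       N * dot (G (x, y)) (G (x, y)) + / M <= delta ^ 2)) r) as (M & HM & HQ).
  - intros x y M M' HMM' [HM HQ]. split; [lra|]. intros Hxy. specialize (HQ Hxy).
    assert (/ M' <= / M) by (apply Rinv_le_contravar; lra). lra.
  - intros x y _. destruct (Rle_or_lt (x ^ 2 + y ^ 2) (r ^ 2)) as [Hxy | Hxy].
    + assert (Him := Hdisk (x, y) ltac:(unfold dot; cbn [fst snd]; lra)).
      assert (Hlt : N * dot (G (x, y)) (G (x, y)) < delta ^ 2).
      { destruct Him as (v & Hv & Ev). rewrite <- Ev, HGE by assumption.
        now apply gball_optical in Hv. }
      assert (Hc : continuity_2d_pt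
        (fun u v => N * (coord X1 (G (u, v)) * coord X1 (G (u, v))
                         + coord X2 (G (u, v)) * coord X2 (G (u, v)))) x y).
      { apply (continuity_2d_pt_mult (fun _ _ => N)); [apply continuity_2d_pt_const|].
        apply continuity_2d_pt_plus; apply continuity_2d_pt_mult;
          first [apply (HG X1 0%nat x y Him) | apply (HG X2 0%nat x y Him)]. }
      set (e := delta ^ 2 - N * dot (G (x, y)) (G (x, y))).
      assert (He : 0 < e / 2) by (unfold e; lra).
      destruct (Hc (mkposreal _ He)) as [d Hd'].
      exists (/ (e / 2)), d. intros u v Hu Hv.
      specialize (Hd' u v Hu Hv). cbn [pos coord] in Hd'.
      apply Rabs_lt_between in Hd'.
      split; [now apply Rinv_0_lt_compat|]. intros _.
      rewrite Rinv_inv. unfold e, dot in *. lra.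
    + assert (Hc : continuity_2d_pt (fun u v => u * u + v * v) x y).
      { apply continuity_2d_pt_plus; apply continuity_2d_pt_mult;
          first [apply continuity_2d_pt_id1 | apply continuity_2d_pt_id2]. }
      assert (He : 0 < x ^ 2 + y ^ 2 - r ^ 2) by lra.
      destruct (Hc (mkposreal _ He)) as [d Hd'].
      exists 1, d. intros u v Hu Hv. specialize (Hd' u v Hu Hv). cbn [pos] in Hd'.
      apply Rabs_lt_between in Hd'. split; [lra|]. intros Hin'. lra.
  (* A squared length closer to [delta ^ 2] than the gap [/ M]; the maximum with [delta ^ 2 / 2]
     keeps it positive. The vector on the radius with this squared length gives the
     contradiction. *)
  - set (s := Rmax (delta ^ 2 / 2) (delta ^ 2 - / M / 2)).
    pose proof (Rinv_0_lt_compat _ HM).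
    assert (Hd2 : 0 < delta ^ 2) by (apply pow_lt; lra).
    assert (Hs : 0 < s < delta ^ 2).
    { split; [apply Rlt_le_trans with (delta ^ 2 / 2); [lra | apply Rmax_l]|].
      apply Rmax_lub_lt; lra. }
    assert (Hs' : delta ^ 2 - / M / 2 <= s) by apply Rmax_r.
    set (l := sqrt (s / N)).
    assert (Hl : 0 < l) by (apply sqrt_lt_R0, Rdiv_lt_0_compat; lra).
    assert (Hl2 : N * l ^ 2 = s).
    { unfold l. rewrite pow2_sqrt by (apply Rlt_le, Rdiv_lt_0_compat; lra). field; lra. }
    destruct (Hin l Hl ltac:(lra)) as [H1 H2].
    destruct (E (vscale l w)) as [x y]. unfold dot in H1; cbn [fst snd] in H1.
    destruct (HQ x y) as [_ H3].
    + split; apply Rabs_le; nra.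
    + specialize (H3 ltac:(lra)). rewrite H2 in H3.
      replace (dot (vscale l w) (vscale l w)) with (l ^ 2 * dot w w) in H3
        by (unfold dot, vscale; cbn [fst snd]; ring).
      rewrite Hw, Rmult_1_r, Hl2 in H3. lra.
Qed.

Lemma billiard_step_exists (n : R -> R) (r theta alpha : R) (gamma : R -> plane)
  (W : plane -> Prop) :
  riemannian_metric (optical_metric n) -> circle_param r gamma ->
  totally_normal_neighborhood (optical_metric n) W ->
  (forall p, closed_region gamma p -> W p) -> 0 < alpha < PI ->
  exists s', billiard_step n gamma (state theta alpha) s'.
Proof.
  intros Hg Hc (_ & delta & Hd & Hnormal) HW Hal.
  pose proof (proj1 Hc) as Hr.
  assert (HdiskW : forall p, dot p p <= r ^ 2 -> W p).
  { intros p Hp. now apply HW, (disk_closed_region r). }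
  assert (Htr0 : trace gamma (gamma theta)) by now exists theta.
  apply (circle_trace r) in Htr0 as Hq; [| assumption].
  destruct (Hnormal (gamma theta) (HdiskW _ (Req_le _ _ Hq))) as (E & Hexp & Hdiffeo & Himg).
  pose proof (sin2_cos2_pow theta) as Hth. pose proof (sin2_cos2_pow alpha) as Hals.
  pose proof (sin_gt_0 alpha (proj1 Hal) (proj2 Hal)) as Hsin.
  set (w := direction gamma theta alpha).
  assert (Hwval : w = (- cos alpha * sin theta - sin alpha * cos theta,
     cos alpha * cos theta - sin alpha * sin theta)) by now apply (circle_direction r).
  assert (Hw : dot w w = 1).
  { rewrite Hwval. unfold dot; cbn [fst snd].
    transitivity ((sin theta ^ 2 + cos theta ^ 2) * (sin alpha ^ 2 + cos alpha ^ 2));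
      [ring | rewrite Hth, Hals; ring]. }
  destruct (geodesic_ray_leaves_disk n (gamma theta) w delta r E)
    as (l & Hl & Hball & Hout); auto.
  destruct (Hexp _ Hball) as (a & b & c & Ha & Hb & H & H0 & Hv & H1).
  pose proof (geodesic_conformal_flow n a b c Hg H) as F.
  (* [h] is negative inside the circle and zero on it. Its initial derivative is - 2 r l sin alpha,
     negative because [alpha] is in the open interval, and at time 1 the chosen geodesic is
     outside. *)
  set (h := fun t => dot (c t) (c t) - r ^ 2).
  assert (Hh : forall t, a < t < b -> is_derive h t (2 * dot (c t) (velocity c t))).
  { intros t Ht. destruct (F t Ht) as (dx & dy & _).
    unfold h, dot. eapply is_derive_eq.
    - apply (is_derive_minus (K := R_AbsRing) (V := R_NormedModule));
        [| apply (is_derive_const (K := R_AbsRing) (V := R_NormedModule))].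
      apply (is_derive_plus (K := R_AbsRing) (V := R_NormedModule));
        apply (is_derive_mult (K := R_AbsRing)); try eassumption;
        intros; apply Rmult_comm.
    - change minus with Rminus; change plus with Rplus; change mult with Rmult;
        change zero with 0. cbv beta. ring. }
  assert (Hdot0 : dot (c 0) (velocity c 0) = - (r * l * sin alpha)).
  { rewrite H0, Hv, Hwval, (proj2 Hc). unfold dot, vscale; cbn [fst snd].
    transitivity (- (r * l * sin alpha) * (sin theta ^ 2 + cos theta ^ 2));
      [ring | rewrite Hth; ring]. }
  assert (Hrl : 0 < r * l * sin alpha) by (repeat apply Rmult_lt_0_compat; assumption).
  destruct (first_zero_after_descent h (2 * dot (c 0) (velocity c 0)) 1)
    as (t1 & Ht1 & Hz & Hneg).
  - lra.
  - intros t Ht. eapply is_derive_continuity_pt, Hh; lra.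
  - unfold h. rewrite H0, Hq. ring.
  - apply Hh; lra.
  - rewrite Hdot0. lra.
  - unfold h. rewrite H1. lra.
  - assert (Htr : trace gamma (c t1)) by (apply (circle_trace r); [assumption | unfold h in Hz; lra]).
    destruct (geodesic_return_invariants n r a b t1 l alpha theta gamma c)
      as [HE HL]; try assumption; [lra|].
    assert (Hout1 : 0 <= 2 * dot (c t1) (velocity c t1)).
    { apply (derivative_nonneg_from_left h _ t1); [lra | apply Hh; lra |].
      intros t Ht. rewrite Hz. left. now apply Hneg. }
    destruct Htr as [th1 Hth1].
    (* The conservation laws dictate the witnesses: same angle, and same speed [l] after
       reflection. *)
    exists (state th1 alpha), theta, alpha, th1, alpha.
    split; [reflexivity|]. split; [exact Hal|]. split; [reflexivity|]. split; [exact Hal|].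
    exists a, b, t1, l, l, c.
    split; [exact Ha|]. split; [lra|]. split; [exact Hl|]. split; [exact Hl|].
    split; [exact H|]. split; [exact H0|]. split; [exact Hv|].
    split; [| split; [now symmetry|]].
    + intros t Ht Htr. apply (circle_trace r) in Htr; [| assumption].
      specialize (Hneg t Ht). unfold h in Hneg. lra.
    + rewrite (circle_tangent r), (circle_direction r) by assumption.
      rewrite <- Hth1, (proj2 Hc) in HL, Hout1.
      pose proof (sin2_cos2_pow th1) as Hs1.
      destruct (velocity c t1) as [vx vy].
      unfold dot, cross in HE, HL, Hout1; cbn [fst snd] in HE, HL, Hout1.
      (* Radial and tangential components on arrival. Angular momentum fixes [q], energy fixes [p]
         up to sign, and arrival from inside makes [p] nonnegative; reflection then reverses [p]. *)
      set (p := cos th1 * vx + sin th1 * vy).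
      set (q := cos th1 * vy - sin th1 * vx).
      assert (Hq1 : q = l * cos alpha).
      { apply (Rmult_eq_reg_l r); [| lra]. unfold q. lra. }
      assert (Hpq : p ^ 2 + q ^ 2 = l ^ 2).
      { rewrite <- HE. unfold p, q.
        transitivity ((sin th1 ^ 2 + cos th1 ^ 2) * (vx * vx + vy * vy));
          [ring | rewrite Hs1; ring]. }
      assert (Hp1 : p = l * sin alpha).
      { apply Rsqr_inj.
        - apply (Rmult_le_reg_l r); [lra|]. unfold p. lra.
        - apply Rlt_le, Rmult_lt_0_compat; assumption.
        - unfold Rsqr. transitivity (l ^ 2 * (1 - cos alpha ^ 2)).
          + rewrite Hq1 in Hpq. lra.
          + rewrite <- Hals. ring. }
      assert (Hvx : vx = p * cos th1 - q * sin th1).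
      { transitivity ((sin th1 ^ 2 + cos th1 ^ 2) * vx);
          [rewrite Hs1; ring | unfold p, q; ring]. }
      assert (Hvy : vy = p * sin th1 + q * cos th1).
      { transitivity ((sin th1 ^ 2 + cos th1 ^ 2) * vy);
          [rewrite Hs1; ring | unfold p, q; ring]. }
      assert (Hdt : dot (- sin th1, cos th1) (vx, vy) = q)
        by (unfold dot, q; cbn [fst snd]; ring).
      unfold reflect. rewrite Hdt. unfold vscale; cbn [fst snd].
      rewrite Hvx, Hvy, Hp1, Hq1. f_equal; ring.
Qed.

(** * Foliation of the phase cylinder by circles *)

Lemma continuous_pair {U V V' : UniformSpace} (f : U -> V) (g : U -> V') (x : U) :
  continuous f x -> continuous g x -> continuous (fun y => (f y, g y)) x.
Proof.
  intros Hf Hg. apply filterlim_locally. intros eps.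
  apply (filter_imp (fun y => ball (f x) eps (f y) /\ ball (g x) eps (g y))).
  - intros y [H1 H2]. now split.
  - apply filter_and.
    + exact (proj1 (filterlim_locally f (f x)) Hf eps).
    + exact (proj1 (filterlim_locally g (g x)) Hg eps).
Qed.

Lemma continuous_continuous_on {U V : UniformSpace} (D : U -> Prop) (f : U -> V) :
  (forall x, continuous f x) -> continuous_on D f.
Proof.
  intros Hf x _. apply (filterlim_filter_le_1 (F := locally x)).
  - apply filter_le_within.
  - apply Hf.
Qed.

Lemma continuous_fst_comp {U V V' : UniformSpace} (f : U -> V * V') (x : U) :
  continuous f x -> continuous (fun y => fst (f y)) x.
Proof.
  intros Hf. apply (continuous_comp f fst); [exact Hf|].
  destruct (f x). apply continuous_fst.
Qed.

Lemma continuous_snd_comp {U V V' : UniformSpace} (f : U -> V * V') (x : U) :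
  continuous f x -> continuous (fun y => snd (f y)) x.
Proof.
  intros Hf. apply (continuous_comp f snd); [exact Hf|].
  destruct (f x). apply continuous_snd.
Qed.

Lemma continuous_Rmult {U : UniformSpace} (f g : U -> R) (x : U) :
  continuous f x -> continuous g x -> continuous (fun y => f y * g y) x.
Proof. exact (continuous_mult (K := R_AbsRing) f g x). Qed.

Lemma continuous_Rplus {U : UniformSpace} (f g : U -> R) (x : U) :
  continuous f x -> continuous g x -> continuous (fun y => f y + g y) x.
Proof. exact (continuous_plus (V := R_NormedModule) f g x). Qed.

Lemma continuous_Rminus {U : UniformSpace} (f g : U -> R) (x : U) :
  continuous f x -> continuous g x -> continuous (fun y => f y - g y) x.
Proof. exact (continuous_minus (V := R_NormedModule) f g x). Qed.

Lemma continuous_phase_coordinates (s : phase) :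
  continuous (fun y : phase => fst (fst y)) s /\
  continuous (fun y : phase => snd (fst y)) s /\
  continuous (fun y : phase => snd y) s.
Proof.
  pose proof (continuous_id s) as H.
  pose proof (continuous_fst_comp (fun y : phase => y) s H) as H1.
  split; [| split].
  - exact (continuous_fst_comp (fun y : phase => fst y) s H1).
  - exact (continuous_snd_comp (fun y : phase => fst y) s H1).
  - exact (continuous_snd_comp (fun y : phase => y) s H).
Qed.

Lemma enorm_eq_1 (p : plane) : enorm p = 1 <-> fst p ^ 2 + snd p ^ 2 = 1.
Proof.
  unfold enorm. split; intros H.
  - rewrite <- (sqrt_sqrt (fst p ^ 2 + snd p ^ 2)), H; [ring|].
    pose proof (pow2_ge_0 (fst p)). pose proof (pow2_ge_0 (snd p)). lra.
  - rewrite H. apply sqrt_1.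
Qed.

Lemma enorm_cos_sin (theta : R) : enorm (cos theta, sin theta) = 1.
Proof. apply enorm_eq_1; cbn [fst snd]. rewrite <- (sin2_cos2_pow theta). ring. Qed.

Definition level_circle (alpha : R) (s : phase) : Prop :=
  enorm (fst s) = 1 /\ snd s = alpha.

Definition level_curve (alpha t : R) : phase := state (2 * PI * t) alpha.

Lemma level_curve_image (alpha : R) (s : phase) :
  level_circle alpha s <-> exists t, unit_interval t /\ level_curve alpha t = s.
Proof.
  unfold level_circle, level_curve, unit_interval. pose proof PI_RGT_0. split.
  - intros [H1 H2]. apply enorm_eq_1 in H1.
    destruct (unit_vector_angle _ _ H1) as (theta & Htheta & Hc & Hs).
    exists (theta / (2 * PI)). split.
    + split; [apply Rdiv_le_0_compat; lra|].
      apply (Rmult_le_reg_r (2 * PI)); [lra|]. field_simplify; lra.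
    + replace (2 * PI * (theta / (2 * PI))) with theta by (field; lra).
      unfold state. rewrite <- Hc, <- Hs, <- H2.
      destruct s as [[? ?] ?]; reflexivity.
  - intros (t & _ & <-). split; [apply enorm_cos_sin | reflexivity].
Qed.

Lemma level_curve_simple_closed (alpha : R) :
  0 < alpha < PI -> simple_closed_curve (level_curve alpha).
Proof.
  intros Hal. unfold level_curve. repeat split.
  - apply enorm_cos_sin.
  - apply Hal.
  - apply Hal.
  - apply continuous_continuous_on. intros t.
    assert (Hlin : continuous (fun s => 2 * PI * s) t).
    { apply continuous_Rmult; [apply continuous_const | apply continuous_id]. }
    apply continuous_pair; [apply continuous_pair | apply continuous_const].
    + apply (continuous_comp (fun s => 2 * PI * s) cos); [exact Hlin | apply continuous_cos].
    + apply (continuous_comp (fun s => 2 * PI * s) sin); [exact Hlin | apply continuous_sin].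
  - apply state_eq. rewrite Rmult_0_r, Rmult_1_r, cos_0, sin_0, cos_2PI, sin_2PI. tauto.
  - intros t t' Ht Ht' E. apply state_eq in E. destruct E as (Ec & Es & _).
    destruct (cos_sin_eq_mod_2PI _ _ Ec Es) as [k Hk]. pose proof PI_RGT_0.
    assert (Htk : t = t' + IZR k) by (apply (Rmult_eq_reg_l (2 * PI)); lra).
    assert (Hk0 : (-1 < k < 1)%Z) by (split; apply lt_IZR; lra).
    replace k with 0%Z in Htk by lia. lra.
Qed.

(** * Level curves are not contractible *)

(** In the open right half-plane, [atan (c / d)] is a continuous choice of the angle of the unit
    vector [(d, c)]. *)
Lemma cos_sin_atan_div (c d : R) :
  0 < d -> c ^ 2 + d ^ 2 = 1 -> cos (atan (c / d)) = d /\ sin (atan (c / d)) = c.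
Proof.
  intros Hd H.
  assert (E : sqrt (1 + (c / d)²) = / d).
  { replace (1 + (c / d)²) with ((/ d) ^ 2).
    - apply sqrt_pow2. now apply Rlt_le, Rinv_0_lt_compat.
    - transitivity ((c ^ 2 + d ^ 2) / d ^ 2); [rewrite H |]; unfold Rsqr; field; lra. }
  rewrite cos_atan, sin_atan, E. split; field; lra.
Qed.

(** Winding number one of the loop [(X, Y)] in the unit circle, stated through a continuous angle so
    that no general degree is required. *)
Definition has_lift_of_degree_1 (X Y : R -> R) : Prop :=
  exists theta : R -> R,
    (forall t, 0 <= t <= 1 -> continuity_pt theta t) /\
    (forall t, 0 <= t <= 1 -> X t = cos (theta t) /\ Y t = sin (theta t)) /\
    theta 1 = theta 0 + 2 * PI.

(** Where the inner product is positive, the angle from one unit vector to the other is [atan] of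
    cross product over inner product. Added to the given lift it lifts the second loop, and it takes
    equal values at both ends because both loops are closed. *)
Lemma lift_of_nearby_loop (X Y X' Y' : R -> R) :
  (forall t, 0 <= t <= 1 -> continuity_pt X t /\ continuity_pt Y t) ->
  (forall t, 0 <= t <= 1 -> continuity_pt X' t /\ continuity_pt Y' t) ->
  (forall t, 0 <= t <= 1 -> X t ^ 2 + Y t ^ 2 = 1 /\ X' t ^ 2 + Y' t ^ 2 = 1) ->
  (forall t, 0 <= t <= 1 -> 0 < X t * X' t + Y t * Y' t) ->
  X 0 = X 1 -> Y 0 = Y 1 -> X' 0 = X' 1 -> Y' 0 = Y' 1 ->
  has_lift_of_degree_1 X Y -> has_lift_of_degree_1 X' Y'.
Proof.
  intros Hc Hc' Hn Hpos HX HY HX' HY' (theta & Hth & Hlift & Hdeg).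
  exists (fun t => theta t
    + atan ((X t * Y' t - Y t * X' t) / (X t * X' t + Y t * Y' t))).
  split; [| split].
  - intros t Ht. destruct (Hc t Ht), (Hc' t Ht).
    apply (continuity_pt_plus theta); [now apply Hth|].
    apply (continuity_pt_comp
      (fun t => (X t * Y' t - Y t * X' t) / (X t * X' t + Y t * Y' t)) atan).
    + apply (continuity_pt_div (fun t => X t * Y' t - Y t * X' t)
        (fun t => X t * X' t + Y t * Y' t)).
      * apply (continuity_pt_minus (fun t => X t * Y' t) (fun t => Y t * X' t));
          now apply continuity_pt_mult.
      * apply (continuity_pt_plus (fun t => X t * X' t) (fun t => Y t * Y' t));
          now apply continuity_pt_mult.
      * now apply Rgt_not_eq, Hpos.
    + apply derivable_continuous_pt, derivable_pt_atan.
  - intros t Ht. destruct (Hn t Ht) as [N N'], (Hlift t Ht) as [Lx Ly].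
    destruct (cos_sin_atan_div (X t * Y' t - Y t * X' t) (X t * X' t + Y t * Y' t))
      as [Ec Es]; [now apply Hpos | |].
    + transitivity ((X t ^ 2 + Y t ^ 2) * (X' t ^ 2 + Y' t ^ 2)); [ring|].
      rewrite N, N'. ring.
    + rewrite cos_plus, sin_plus, Ec, Es, <- Lx, <- Ly. split.
      * transitivity ((X t ^ 2 + Y t ^ 2) * X' t); [rewrite N |]; ring.
      * transitivity ((X t ^ 2 + Y t ^ 2) * Y' t); [rewrite N |]; ring.
  - rewrite Hdeg, HX, HY, HX', HY'. ring.
Qed.

(** By the intermediate value theorem a lift gaining 2 PI passes through [theta 0 + PI], where the
    loop would be at the antipode of its constant value. *)
Lemma constant_loop_no_lift (x y : R) (X Y : R -> R) :
  (forall t, 0 <= t <= 1 -> X t = x /\ Y t = y) -> ~ has_lift_of_degree_1 X Y.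
Proof.
  intros Hconst (theta & Hc & Hlift & Hdeg). pose proof PI_RGT_0.
  destruct (IVT_interv (fun t => theta t - (theta 0 + PI)) 0 1) as (z & Hz & Ez).
  - intros t Ht. apply (continuity_pt_minus theta (fun _ => theta 0 + PI));
      [now apply Hc | now apply continuity_pt_const].
  - lra.
  - lra.
  - lra.
  - destruct (Hlift z Hz) as [Cz Sz], (Hlift 0 ltac:(lra)) as [C0 S0].
    destruct (Hconst z Hz) as [Kx Ky], (Hconst 0 ltac:(lra)) as [K0x K0y].
    replace (theta z) with (theta 0 + PI) in Cz, Sz by lra.
    rewrite neg_cos in Cz. rewrite neg_sin in Sz.
    apply (cos_sin_0 (theta 0)). lra.
Qed.

(** A retraction of the line onto [0, 1]. It extends a homotopy, continuous only relative to the
    square, to a map of the plane that is continuous in the two-sided sense. *)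
Definition clamp (t : R) : R := Rmax 0 (Rmin 1 t).

Lemma clamp_unit_interval (t : R) : unit_interval (clamp t).
Proof.
  unfold unit_interval, clamp, Rmax, Rmin.
  destruct (Rle_dec 1 t); destruct (Rle_dec 0 _); lra.
Qed.

Lemma clamp_id (t : R) : unit_interval t -> clamp t = t.
Proof.
  unfold unit_interval, clamp, Rmax, Rmin. intros Ht.
  destruct (Rle_dec 1 t); destruct (Rle_dec 0 _); lra.
Qed.

Lemma clamp_lipschitz (s t : R) : Rabs (clamp s - clamp t) <= Rabs (s - t).
Proof.
  unfold clamp, Rmax, Rmin.
  destruct (Rle_dec 1 t); destruct (Rle_dec 1 s);
    repeat destruct (Rle_dec 0 _); unfold Rabs; repeat destruct Rcase_abs; lra.
Qed.

Lemma continuous_on_clamp {V : UniformSpace} (H : R * R -> V) (z : R * R) :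
  continuous_on (fun z => unit_interval (fst z) /\ unit_interval (snd z)) H ->
  continuous (fun z => H (clamp (fst z), clamp (snd z))) z.
Proof.
  intros HH.
  assert (Hin : forall z, unit_interval (clamp (fst z)) /\ unit_interval (clamp (snd z)))
    by (intros; split; apply clamp_unit_interval).
  specialize (HH (clamp (fst z), clamp (snd z)) (Hin z)).
  refine (filterlim_comp _ _ _ (fun z => (clamp (fst z), clamp (snd z))) H _ _ _ _ HH).
  intros P [eps HP]. exists eps. intros z' [H1 H2].
  apply HP; [| apply Hin]. split; cbn [fst snd].
  - eapply Rle_lt_trans; [apply clamp_lipschitz | exact H1].
  - eapply Rle_lt_trans; [apply clamp_lipschitz | exact H2].
Qed.

(** By uniform continuity the homotopy splits into finitely many slices whose neighbours are close,
    so the degree-one lift of the level curve propagates to the final constant loop, which has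
    none. *)
Lemma level_curve_essential (alpha : R) : ~ homotopic_to_point (level_curve alpha).
Proof.
  intros (H & s0 & Hcyl & Hcont & Hloop & H0 & H1).
  set (X := fun u t => fst (fst (H (clamp u, clamp t)))).
  set (Y := fun u t => snd (fst (H (clamp u, clamp t)))).
  assert (HX : forall u t, continuity_2d_pt X u t).
  { intros u t. apply continuity_2d_pt_filterlim.
    change (continuous
      (fun z : R * R => fst (fst (H (clamp (fst z), clamp (snd z))))) (u, t)).
    apply continuous_fst_comp, continuous_fst_comp. now apply continuous_on_clamp. }
  assert (HY : forall u t, continuity_2d_pt Y u t).
  { intros u t. apply continuity_2d_pt_filterlim.
    change (continuous
      (fun z : R * R => snd (fst (H (clamp (fst z), clamp (snd z))))) (u, t)).
    apply continuous_snd_comp, continuous_fst_comp. now apply continuous_on_clamp. }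
  assert (Hc : forall (f : R -> R -> R), (forall u t, continuity_2d_pt f u t) ->
    forall u t, continuity_pt (f u) t).
  { intros f Hf u t. apply continuity_pt_locally. intros eps.
    destruct (Hf u t eps) as [d Hd]. exists d. intros t' Ht'.
    apply Hd; [rewrite Rminus_diag, Rabs_R0; apply cond_pos | exact Ht']. }
  assert (Hn : forall u t, X u t ^ 2 + Y u t ^ 2 = 1).
  { intros u t. apply enorm_eq_1.
    apply (Hcyl (clamp u) (clamp t)); apply clamp_unit_interval. }
  assert (Hends : forall u, X u 0 = X u 1 /\ Y u 0 = Y u 1).
  { intros u. unfold X, Y.
    rewrite !(clamp_id 0), !(clamp_id 1) by (unfold unit_interval; lra).
    rewrite (Hloop (clamp u)) by apply clamp_unit_interval. tauto. }
  (* For unit vectors the inner product is 1 minus half the squared distance; coordinate differences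
     below 1/2 keep it above 3/4. *)
  destruct (uniform_continuity_2d X 0 1 0 1 ltac:(auto) (mkposreal (1 / 2) ltac:(lra)))
    as [dX HdX].
  destruct (uniform_continuity_2d Y 0 1 0 1 ltac:(auto) (mkposreal (1 / 2) ltac:(lra)))
    as [dY HdY].
  cbn [pos] in HdX, HdY.
  assert (Hstep : forall u u', 0 <= u <= 1 -> 0 <= u' <= 1 ->
    Rabs (u' - u) < dX -> Rabs (u' - u) < dY ->
    has_lift_of_degree_1 (X u) (Y u) -> has_lift_of_degree_1 (X u') (Y u')).
  { intros u u' Hu Hu' Hux Huy. destruct (Hends u), (Hends u').
    apply lift_of_nearby_loop; auto.
    intros t Ht.
    assert (Hz : forall d : posreal, Rabs (t - t) < d)
      by (intros; rewrite Rminus_diag, Rabs_R0; apply cond_pos).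
    pose proof (HdX u t u' t Hu Ht Hu' Ht Hux (Hz _)) as Dx.
    pose proof (HdY u t u' t Hu Ht Hu' Ht Huy (Hz _)) as Dy.
    apply Rabs_lt_between in Dx, Dy.
    pose proof (Hn u t). pose proof (Hn u' t). nra. }
  destruct (archimed_cor1 (Rmin dX dY)) as (N & HN & HN0).
  { apply Rmin_glb_lt; apply cond_pos. }
  pose proof (Rmin_l dX dY). pose proof (Rmin_r dX dY).
  apply lt_INR in HN0 as HNpos. simpl in HNpos.
  assert (Hall : forall k, (k <= N)%nat ->
    has_lift_of_degree_1 (X (INR k / INR N)) (Y (INR k / INR N))).
  { assert (Hfrac : forall k, (k <= N)%nat -> 0 <= INR k / INR N <= 1).
    { intros k Hk. apply le_INR in Hk. pose proof (pos_INR k). split.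
      - apply Rdiv_le_0_compat; lra.
      - apply (Rmult_le_reg_r (INR N)); [lra|]. field_simplify; lra. }
    induction k as [| k IH]; intros Hk.
    - simpl. unfold Rdiv. rewrite Rmult_0_l. exists (fun t => 2 * PI * t).
      split; [| split; [| ring]].
      + intros t _. apply derivable_continuous_pt. reg.
      + intros t Ht. unfold X, Y.
        rewrite (clamp_id 0), (clamp_id t), H0 by (unfold unit_interval; lra).
        split; reflexivity.
    - assert (Hd : Rabs (INR (S k) / INR N - INR k / INR N) = / INR N).
      { rewrite S_INR. replace (_ - _) with (/ INR N) by (field; lra).
        apply Rabs_right, Rle_ge, Rlt_le, Rinv_0_lt_compat; lra. }
      apply (Hstep (INR k / INR N)); try (rewrite Hd; lra).
      + apply Hfrac; lia.
      + now apply Hfrac.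
      + apply IH; lia. }
  specialize (Hall N ltac:(lia)). rewrite Rdiv_diag in Hall by lra.
  apply (constant_loop_no_lift (fst (fst s0)) (snd (fst s0))) in Hall; [exact Hall|].
  intros t Ht. unfold X, Y.
  rewrite (clamp_id 1), (clamp_id t), H1 by (unfold unit_interval; lra). tauto.
Qed.

(** * The leaves, their charts and their invariance *)

Definition level_leaf (L : phase -> Prop) : Prop :=
  exists alpha, 0 < alpha < PI /\ forall s, L s <-> level_circle alpha s.

Lemma level_leaf_rotational (L : phase -> Prop) : level_leaf L -> rotational_curve L.
Proof.
  intros (alpha & Hal & HL). exists (level_curve alpha).
  split; [now apply level_curve_simple_closed|].
  split; [apply level_curve_essential|].
  intros s. rewrite HL. apply level_curve_image.
Qed.

(* Orthogonal projection of the half circle around [fst s] onto its tangent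
   line, times an affine coordinate for the angle. *)
Lemma level_leaf_chart (s : phase) : cylinder s -> foliation_chart level_leaf s.
Proof.
  destruct s as [[p q] a0]. intros [He Ha0]. cbn [fst snd] in He, Ha0.
  apply enorm_eq_1 in He. cbn [fst snd] in He. pose proof PI_RGT_0 as HPI.
  exists (fun x : phase => cylinder x /\ 0 < dot (p, q) (fst x)),
    (fun x : phase => (cross (p, q) (fst x), 2 * / PI * snd x - 1)),
    (fun z : R * R => ((p * sqrt (1 - fst z * fst z) - q * fst z,
                        q * sqrt (1 - fst z * fst z) + p * fst z),
                       PI / 2 * (snd z + 1))).
  assert (Hsplit : forall v : plane,
    dot (p, q) v ^ 2 + cross (p, q) v ^ 2 = fst v ^ 2 + snd v ^ 2).
  { intros v. transitivity ((p ^ 2 + q ^ 2) * (fst v ^ 2 + snd v ^ 2));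
      [unfold dot, cross; cbn [fst snd]; ring | rewrite He; ring]. }
  repeat apply conj.
  - exact (proj2 (enorm_eq_1 (p, q)) He).
  - exact (proj1 Ha0).
  - exact (proj2 Ha0).
  - unfold dot; cbn [fst snd]. lra.
  - intros x [Hx Hdot]. split; [exact Hx|].
    assert (Hc : continuous (fun y : phase => dot (p, q) (fst y)) x).
    { destruct (continuous_phase_coordinates x) as (C1 & C2 & _).
      unfold dot; cbn [fst snd].
      refine (continuous_Rplus _ _ _ _ _); refine (continuous_Rmult _ _ _ _ _); auto using continuous_const. }
    specialize (Hc _ (open_gt 0 _ Hdot)). unfold filtermap in Hc.
    revert Hc. apply filter_imp. intros y Hy Hcyl. now split.
  - intros [v al] [[Hv Hal] Hdot]. cbn [fst snd] in *.
    apply enorm_eq_1 in Hv. specialize (Hsplit v). rewrite Hv in Hsplit.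
    (* On the half circle the component along [(p, q)] is positive, so it is the nonnegative root
       determined by the component across. *)
    assert (Hroot : sqrt (1 - cross (p, q) v * cross (p, q) v) = dot (p, q) v).
    { rewrite <- (sqrt_pow2 (dot (p, q) v)) by lra. f_equal. lra. }
    split.
    + split; cbn [fst snd]; [nra|].
      assert (Hlt : 0 < / PI * al < 1).
      { split; [apply Rmult_lt_0_compat; [now apply Rinv_0_lt_compat | lra]|].
        apply (Rmult_lt_reg_l PI); [lra|]. field_simplify; lra. }
      lra.
    + rewrite Hroot. apply injective_projections; cbn [fst snd]; [| field; lra].
      apply injective_projections; unfold dot, cross; cbn [fst snd].
      * transitivity ((p ^ 2 + q ^ 2) * fst v); [ring | rewrite He; ring].
      * transitivity ((p ^ 2 + q ^ 2) * snd v); [ring | rewrite He; ring].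
  - intros [a b] [Ha Hb]. cbn [fst snd] in *.
    assert (Hpos : 0 < 1 - a * a) by nra.
    pose proof (sqrt_lt_R0 _ Hpos) as Hr. pose proof (sqrt_sqrt (1 - a * a) ltac:(lra)) as Hrr.
    set (r := sqrt (1 - a * a)) in *.
    split; [split; [split|]|]; cbn [fst snd].
    + apply enorm_eq_1; cbn [fst snd].
      transitivity ((p ^ 2 + q ^ 2) * (r * r + a * a)); [ring | rewrite He, Hrr; ring].
    + split; [apply Rmult_lt_0_compat; lra|]. nra.
    + unfold dot; cbn [fst snd].
      replace (_ + _) with ((p ^ 2 + q ^ 2) * r) by ring. rewrite He. lra.
    + apply injective_projections; cbn [fst snd]; [| field; lra].
      unfold cross; cbn [fst snd].
      transitivity ((p ^ 2 + q ^ 2) * a); [ring | rewrite He; ring].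
  - apply continuous_continuous_on. intros x.
    destruct (continuous_phase_coordinates x) as (C1 & C2 & C3).
    refine (continuous_pair _ _ _ _ _).
    + unfold cross; cbn [fst snd].
      refine (continuous_Rminus _ _ _ _ _); refine (continuous_Rmult _ _ _ _ _); auto using continuous_const.
    + refine (continuous_Rminus _ _ _ _ _); [refine (continuous_Rmult _ _ _ _ _)|]; auto using continuous_const.
  - apply continuous_continuous_on. intros z.
    assert (H1 : continuous (fun z : R * R => fst z) z)
      by exact (continuous_fst_comp (fun z : R * R => z) z (continuous_id z)).
    assert (H2 : continuous (fun z : R * R => snd z) z)
      by exact (continuous_snd_comp (fun z : R * R => z) z (continuous_id z)).
    (* [sqrt] is 0 on negative numbers and continuous on the whole line, so continuity holds at
       every [z], inside the box or not. *)
    assert (Hr : continuous (fun z : R * R => sqrt (1 - fst z * fst z)) z).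
    { apply (continuous_comp (fun z : R * R => 1 - fst z * fst z) sqrt);
        [| apply continuous_sqrt].
      refine (continuous_Rminus _ _ _ _ _); [apply continuous_const | now refine (continuous_Rmult _ _ _ _ _)]. }
    refine (continuous_pair _ _ _ (continuous_pair _ _ _ _ _) _).
    + refine (continuous_Rminus _ _ _ _ _); refine (continuous_Rmult _ _ _ _ _); auto using continuous_const.
    + refine (continuous_Rplus _ _ _ _ _); refine (continuous_Rmult _ _ _ _ _); auto using continuous_const.
    + refine (continuous_Rmult _ _ _ _ _); [apply continuous_const|].
      refine (continuous_Rplus _ _ _ _ _); auto using continuous_const.
  - intros x y L _ [[Hy _] _] E (alpha & _ & HL) HLx. cbn [snd] in E.
    apply HL in HLx. apply HL. split; [exact Hy|]. destruct HLx as [_ <-].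
    apply (Rmult_eq_reg_l (2 * / PI)); [lra|].
    apply Rgt_not_eq, Rmult_lt_0_compat; [lra | now apply Rinv_0_lt_compat].
Qed.

Lemma level_leaf_foliation : foliation level_leaf.
Proof.
  split; [| split; [| split]].
  - intros L s (alpha & Hal & HL) Hs. apply HL in Hs. destruct Hs as [H1 H2].
    split; [exact H1 | now rewrite H2].
  - intros s [H1 H2]. exists (level_circle (snd s)). split; [| now split].
    exists (snd s). split; [exact H2 | tauto].
  - intros L L' s (alpha & _ & HL) (alpha' & _ & HL') Hs Hs' x.
    rewrite HL, HL'. apply HL in Hs. apply HL' in Hs'.
    destruct Hs as [_ <-], Hs' as [_ <-]. tauto.
  - exact level_leaf_chart.
Qed.

Lemma cylinder_state (s : phase) : cylinder s -> exists theta, s = state theta (snd s).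
Proof.
  intros [H _]. apply enorm_eq_1 in H.
  destruct (unit_vector_angle _ _ H) as (theta & _ & Hc & Hs).
  exists theta. unfold state. rewrite <- Hc, <- Hs. now destruct s as [[? ?] ?].
Qed.

(* Rotational symmetry makes [T] a rotation on each circle, hence onto. *)
Lemma level_leaf_invariant (n : R -> R) (r : R) (gamma : R -> plane)
  (T : phase -> phase) (L : phase -> Prop) :
  riemannian_metric (optical_metric n) -> circle_param r gamma ->
  optical_billiard_map n gamma T -> level_leaf L -> invariant T L.
Proof.
  intros Hg Hc HT (alpha & Hal & HL) s.
  assert (Hstep : forall x, level_circle alpha x -> billiard_step n gamma x (T x)).
  { intros x [H1 H2]. apply HT; [| reflexivity]. split; [exact H1 | now rewrite H2]. }
  assert (HTL : forall x, level_circle alpha x -> level_circle alpha (T x)).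
  { intros x Hx. specialize (Hstep x Hx). split.
    - destruct Hstep as (th0 & al0 & th1 & al1 & _ & _ & -> & _).
      apply enorm_cos_sin.
    - rewrite (billiard_step_angle n r gamma _ _ Hg Hc Hstep). apply Hx. }
  assert (Hstate : forall theta, level_circle alpha (state theta alpha))
    by (intros; split; [apply enorm_cos_sin | reflexivity]).
  assert (Hform : forall x, level_circle alpha x -> exists theta, x = state theta alpha).
  { intros x [H1 H2]. destruct (cylinder_state x) as [theta E].
    - split; [exact H1 | now rewrite H2].
    - exists theta. now rewrite <- H2. }
  split.
  - intros Hs. apply HL in Hs. destruct (Hform s Hs) as [theta ->].
    destruct (Hform _ (HTL _ (Hstate 0))) as [theta1 E].
    (* If [T] moves the angle 0 to [theta1], equivariance makes it move [theta - theta1] to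
       [theta]. *)
    exists (state (0 + (theta - theta1)) alpha). split; [apply HL, Hstate|].
    pose proof (billiard_step_rotate n r (theta - theta1) gamma _ _ Hg Hc
                  (Hstep _ (Hstate 0))) as B.
    rewrite E, !rotate_state in B. symmetry.
    replace (theta1 + (theta - theta1)) with theta in B by ring.
    apply HT; [| exact B]. split; [apply enorm_cos_sin | exact Hal].
  - intros (s' & Hs' & <-). apply HL, HTL, HL, Hs'.
Qed.

Theorem theorem2
  (n : R -> R)
  (Hn : refractive_index n)
  (Hg : riemannian_metric (optical_metric n))
  (gamma : R -> plane) (rho : R)
  (Hpolar : polar_parametrization gamma)
  (Hcircle : geodesic_circle (optical_metric n) (0, 0)%R rho (trace gamma))
  (W : plane -> Prop)
  (HW : totally_normal_neighborhood (optical_metric n) W)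
  (Hregion : forall p, closed_region gamma p -> W p) :
  exists T : phase -> phase,
    optical_billiard_map n gamma T /\ totally_integrable T.
Proof.
  destruct (polar_geodesic_circle n gamma rho Hg Hpolar Hcircle) as [r Hc].
  fold (circle_param r gamma) in Hc.
  (* Choice needs a value at every point, so the relation is guarded by [cylinder s]; off the
     cylinder any value will do. *)
  destruct (functional_choice
    (fun s s' => cylinder s -> billiard_step n gamma s s')) as [T HT].
  { intros s. destruct (classic (cylinder s)) as [Hs | Hs].
    - destruct (cylinder_state s Hs) as [theta ->].
      destruct (billiard_step_exists n r theta (snd s) gamma W Hg Hc HW Hregion (proj2 Hs))
        as [s' B]. now exists s'.
    - exists s. tauto. }
  assert (HTmap : optical_billiard_map n gamma T).
  { intros s Hs s'. split; [| intros ->; now apply HT].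
    intros B. eapply billiard_step_unique; eauto. }
  exists T. split; [exact HTmap|].
  exists level_leaf. split; [exact level_leaf_foliation|].
  intros L HL. split; [now apply level_leaf_rotational|].
  now apply (level_leaf_invariant n r gamma).
Qed.
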